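(* Given $L\in\mathcal{L}$, let $A_1,\ldots,A_m$ be non-negative matrices that define operators on $L$. Then $$\rho(\exp(A_1\circ\cdots\circ A_m))\le\rho(\exp(A_1\cdots A_m)).$$
   Context: Let $R$ be either $\{1,\ldots,n\}$ for some $n\in\mathbb{N}$ or $\mathbb{N}$, and let $S(R)$ be the vector lattice of all complex sequences $(x_i)_{i\in R}$. A Banach space $L\subseteq S(R)$ is a Banach sequence space if $x\in S(R)$, $y\in L$ and $|x|\le|y|$ (coordinatewise) imply $x\in L$ and $\|x\|_L\le\|y\|_L$. $\mathcal{L}$ is the collection of all Banach sequence spaces $L$ such that $e_i=\chi_{\{i\}}\in L$ and $\|e_i\|_L=1$ for all $i\in R$. A matrix $A=[a_{ij}]_{i,j\in R}$ (possibly infinite) is non-negative if $a_{ij}\ge0$ for all $i,j\in R$. A non-negative matrix $A$ defines an operator on $L$ if $Ax\in L$ for all $x\in L$, where $(Ax)_i=\sum_{j\in R}a_{ij}x_j$; this operator is automatically bounded, and $A$ is identified with it. $\rho(A)$ is the spectral radius; juxtaposition is the ordinary matrix product, and $A\circ B=[a_{ij}b_{ij}]_{i,j\in R}$ is the Hadamard product (which, for $L\in\mathcal{L}$, again defines an operator on $L$). $\exp(A)=\sum_{j=0}^\infty A^j/j!$ is the operator exponential (ordinary, not Hadamard, powers). *)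

(* Defs.v *)
From HB Require Import structures.
From mathcomp Require Import all_boot all_order all_algebra.
From mathcomp Require Import complex.
From mathcomp Require Import all_classical all_reals all_analysis.

Set Implicit Arguments.
Unset Strict Implicit.
Unset Printing Implicit Defensive.

Import Order.TTheory GRing.Theory Num.Theory.
Import numFieldNormedType.Exports.

Local Open Scope classical_set_scope.
Local Open Scope ring_scope.
Local Open Scope complex_scope.

(* The index sets {1, ..., n} with n >= 1, and N; [Initial n] has n + 1
   elements, so that the index set is never empty. *)
Inductive index_set := Initial of nat | AllNat.

Definition idx (I : index_set) : countType :=
  match I with Initial n => 'I_n.+1 | AllNat => nat end.

(* Sum of the terms of index < k.  When I is finite this is eventually constant
   in k, so that convergence is automatic and the limit is the finite sum. *)
Definition partial_sum (V : nmodType) (I : index_set) :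
    (idx I -> V) -> nat -> V :=
  match I with
  | Initial n => fun x k => \sum_(i < n.+1 | (i < k)%N) x i
  | AllNat => fun x k => \sum_(i < k) x i
  end.

Section BanachSequenceSpaces.
Variables (R : realType) (I : index_set).

(* [R[i]^o] is R[i] with its topology and its module structure over itself. *)
Definition complex_seq := idx I -> R[i]^o.

(* A Banach space of sequences is given as an abstract Banach space together
   with its linear inclusion [bcoords] in the space of all sequences.  The norm
   of a normed module over R[i] takes values in R[i]; these are nonnegative reals,
   and <= on R[i] restricts to the usual order on the reals. *)
Record banachSeqSpace := BanachSeqSpace {
  bspace :> completeNormedModType R[i] ;
  bcoords : {linear bspace -> (idx I -> R[i]^o)} ;
  bcoords_inj : injective bcoords ;
  bspace_solid : forall (x : complex_seq) (y : bspace),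
    (forall i, `|x i| <= `|bcoords y i|) ->
    exists2 z : bspace, bcoords z = x & `|z| <= `|y| }.

Arguments bcoords {b}.

Definition unit_seq (i : idx I) : complex_seq := fun j => (j == i)%:R.

(* Membership in the class \mathcal{L}. *)
Definition normalized (L : banachSeqSpace) :=
  forall i, exists2 e : L, bcoords e = unit_seq i & `|e| = 1.

End BanachSequenceSpaces.

Arguments bcoords {R I b}.

Section Matrices.
Variables (R : realType) (I : index_set).

Definition imatrix := idx I -> idx I -> R.

Implicit Types A B : imatrix.

Definition nonneg_mx A := forall i j, 0 <= A i j.

Definition mx_one : imatrix := fun i j => (i == j)%:R.

Definition mx_mul A B : imatrix :=
  fun i j => limn (partial_sum (fun k => A i k * B k j)).

(* A_1 ... A_m; the bigop nests to the right and ends with [mx_one]. *)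
Definition mx_prod (m : nat) (A : 'I_m -> imatrix) : imatrix :=
  \big[mx_mul/mx_one]_(k < m) A k.

Definition hadamard_prod (m : nat) (A : 'I_m -> imatrix) : imatrix :=
  fun i j => \prod_(k < m) A k i j.

Definition mx_term A (x : complex_seq R I) (i : idx I) : complex_seq R I :=
  fun j => (A i j)%:C * x j.

Definition mx_apply A (x : complex_seq R I) : complex_seq R I :=
  fun i => limn (partial_sum (mx_term A x i)).

Definition defines_operator (L : banachSeqSpace R I) A :=
  forall x : L,
    (forall i, cvgn (partial_sum (mx_term A (bcoords x) i))) /\
    exists y : L, bcoords y = mx_apply A (bcoords x).

(* The operator identified with A: by injectivity of [bcoords] the image of x is
   unique; the value is irrelevant when A does not define an operator on L. *)
Definition mx_op (L : banachSeqSpace R I) A : L -> L :=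
  fun x => get [set y : L | bcoords y = mx_apply A (bcoords x)].

End Matrices.

Arguments mx_op {R I} L A.

Section BoundedOperators.
Variables (R : realType) (E : normedModType R[i]).

(* Convergence in operator norm: |T_k - T| <= e for k large enough. *)
Definition op_cvg (T_ : nat -> E -> E) (T : E -> E) :=
  forall e : R, 0 < e ->
    \forall k \near \oo, forall x, `|T_ k x - T x| <= e%:C * `|x|.

(* The sum, for the operator norm, of T^j / j!. *)
Definition op_exp (T : E -> E) : E -> E :=
  get [set S | op_cvg (fun k x => \sum_(j < k) (j`!%:R^-1 : R[i]) *: iter j T x) S].

(* The l for which l - T has no inverse among the bounded operators on E. *)
Definition spectrum (T : E -> E) : set R[i] :=
  [set l | ~ exists S : {linear E -> E},
      [/\ continuous S,
          forall x, S (l *: x - T x) = x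
        & forall x, l *: S x - T (S x) = x]].

Definition spectral_radius (T : E -> E) : R :=
  sup [set complex.Re `|l| | l in spectrum T].

End BoundedOperators.

(* Main.v *)
(* Let H be the Hadamard product, P the ordinary product, and let r exceed the
   spectral radius of exp(P).  All resolvents (t - exp P)^-1 with t >= r exist,
   and following them from t = +oo down to t = r with Neumann series shows that
   they are positive.  So x >= 0 gives y = (r - exp P)^-1 x >= 0 with
   exp(P) y <= r y, and a truncated divided difference (e^s - e^P)/(s - P), with
   e^s slightly larger than r, turns y into some z >= 0 with P z <= s z and
   x <= s z; hence |P^n x| <= C s^n |x|.

   With indices modulo m, H^N <= prod_i (A_i A_(i+1) ... A_(i+N-1)) entrywise.
   Each factor is a power of P up to bounded operators at both ends, and the
   entries of an operator on L are at most its norm, so |H^N| <= c s^N.  Then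
   |exp(H)^k| <= c e^(ks), and the Neumann series bounds the spectral radius of
   exp(H) by e^s. *)

Require Import Defs.
From HB Require Import structures.
From mathcomp Require Import all_boot all_order all_algebra.
From mathcomp Require Import complex.
From mathcomp Require Import all_classical all_reals all_analysis.
From mathcomp Require Import ring lra.

Set Implicit Arguments.
Unset Strict Implicit.
Unset Printing Implicit Defensive.

Import Order.TTheory GRing.Theory Num.Theory.
Import numFieldNormedType.Exports.
Local Open Scope classical_set_scope.
Local Open Scope ring_scope.
Local Open Scope complex_scope.

(** The obstacle is to come back from exp(P) to P: the Hadamard inequality compares powers of H with
    powers of P, while the hypothesis speaks of the spectrum of exp(P). The bridge is algebraic.
    Since s - P divides each s^i - P^i with a quotient that has nonnegative coefficients, z is a
    positive polynomial in P applied to y, and s - P is never inverted. Truncating costs nothing: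
    exp(P) exceeds its partial sums on positive vectors, and e^s > t leaves room for a partial sum
    of e^s that is still at least t.

    All cyclic rotations of the product occur because, in expanding a row of H^N, each A_i is
    followed by its own successor A_(i+1), so the m factors start at m different places. The rate
    comes out right only over whole periods: for N = n m every rotation grows like s^n, and the
    product of the m rotations like s^(n m) = s^N. One rotation is kept as an operator and the
    others are replaced by scalar bounds on their entries, which turns an entrywise inequality into
    an inequality of norms. *)

(** * Real-valued norms and absolutely convergent series *)

Lemma normc_Re (R : realType) (a : R[i]) : `|a| = (complex.Re `|a|)%:C.
Proof.
have := normr_ge0 a; case: `|a| => u v.
by rewrite lecE /= => /andP[/eqP -> _].
Qed.

Section RealNorm.
Variables (R : realType) (E : normedModType R[i]).
Implicit Types (x y : E).

(** The norm has values in [R[i]]; by [nrmE] its real part loses nothing, and it lives in an ordered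
    field with suprema and limits. *)
Definition nrm x : R := complex.Re `|x|.

Lemma nrmE x : `|x| = (nrm x)%:C.
Proof.
rewrite /nrm; have := normr_ge0 x; case: `|x| => a b.
by rewrite lecE /= => /andP[/eqP -> _].
Qed.

Lemma nrm_le x y : (nrm x <= nrm y) = (`|x| <= `|y|).
Proof. by rewrite !nrmE lecR. Qed.

Lemma nrm_ge0 x : 0 <= nrm x.
Proof. by rewrite -ler0c -nrmE. Qed.

Lemma nrm0 : nrm 0 = 0.
Proof. by rewrite /nrm normr0. Qed.

Lemma nrm_eq0 x : nrm x = 0 -> x = 0.
Proof. by move=> h; apply/eqP; rewrite -normr_eq0 nrmE h. Qed.

Lemma nrmN x : nrm (- x) = nrm x.
Proof. by rewrite /nrm normrN. Qed.

Lemma nrmD x y : nrm (x + y) <= nrm x + nrm y.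
Proof. by rewrite -lecR rmorphD /= -!nrmE ler_normD. Qed.

Lemma nrmB x y : nrm (x - y) <= nrm x + nrm y.
Proof. by rewrite -(nrmN y) nrmD. Qed.

Lemma nrm_distC x y : nrm (x - y) = nrm (y - x).
Proof. by rewrite -nrmN opprB. Qed.

Lemma nrmZ (a : R[i]) x : nrm (a *: x) = complex.Re `|a| * nrm x.
Proof.
by apply: complexI; rewrite -nrmE normrZ normc_Re nrmE -rmorphM.
Qed.

Lemma normcR (a : R) : complex.Re `|a%:C| = `|a|.
Proof. by rewrite /= expr0n addr0 sqrtr_sqr. Qed.

Lemma nrmZr (a : R) x : nrm (a%:C *: x) = `|a| * nrm x.
Proof. by rewrite nrmZ normcR. Qed.

Lemma nrmZp (a : R) x : 0 <= a -> nrm (a%:C *: x) = a * nrm x.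
Proof. by move=> a0; rewrite nrmZr ger0_norm. Qed.

Lemma nrm_sum (J : Type) (r : seq J) (P : pred J) (F : J -> E) :
  nrm (\sum_(j <- r | P j) F j) <= \sum_(j <- r | P j) nrm (F j).
Proof.
elim/big_ind2: _ => //; first by rewrite nrm0.
by move=> x a y b xa yb; apply: le_trans (nrmD _ _) (lerD _ _).
Qed.

Lemma nrm_cvgP (u : nat -> E) (l : E) : (u @ \oo --> l) <->
  (forall e : R, 0 < e -> exists N, forall n, (N <= n)%N -> nrm (l - u n) <= e).
Proof.
rewrite cvgrPdist_le; split=> h e e0.
  have /h [N _ hN] : 0 < e%:C :> R[i] by rewrite ltcR.
  by exists N => n Nn; rewrite -lecR -nrmE; apply: hN.
have [e_re e_gt] : e = (complex.Re e)%:C /\ 0 < complex.Re e.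
  by move: e0; case: e => a b; rewrite ltcE /= => /andP[/eqP -> ->].
have [N hN] := h _ e_gt.
by exists N => // n Nn; rewrite e_re nrmE lecR; apply: hN.
Qed.

Lemma nrm_small x : (forall e : R, 0 < e -> nrm x <= e) -> x = 0.
Proof.
move=> h; apply: nrm_eq0; apply/eqP; rewrite eq_le nrm_ge0 andbT.
by apply/ler_addgt0Pr => e e0; rewrite add0r h.
Qed.

End RealNorm.

(** The partial sums are Cauchy because their increments are bounded by those of the series of c.
    The explicit tail estimate is kept because it later makes operator series converge uniformly in
    the vector. *)
Lemma summable_sum (R : realType) (E : completeNormedModType R[i])
    (v : nat -> E) (c : nat -> R) :
  (forall n, nrm (v n) <= c n) -> cvgn (series c) ->
  exists V, forall N,
    nrm (V - \sum_(j < N) v j) <= limn (series c) - series c N.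
Proof.
move=> vc cc.
have c0 n : 0 <= c n by exact: le_trans (nrm_ge0 _) (vc n).
have homc : {homo series c : n m / (n <= m)%N >-> n <= m}.
  apply: nondecreasing_series => n _ _; exact: c0.
pose S N := \sum_(j < N) v j.
have Sd N k : nrm (S (N + k)%N - S N) <= series c (N + k)%N - series c N.
  elim: k => [|k IH]; first by rewrite addn0 !subrr nrm0.
  rewrite addnS /S big_ord_recr /= -/(S (N + k)%N) seriesSr addrAC.
  apply: le_trans (nrmD _ _) _; rewrite addrAC; exact: lerD.
have Scauchy : cauchy (S @ \oo).
  apply/cauchy_ballP => e e0.
  have [e_re e_gt] : e = (complex.Re e)%:C /\ 0 < complex.Re e.
    by move: e0; case: e => a b; rewrite ltcE /= => /andP[/eqP -> ->].
  (* Two deviations of at most e/4 from the same [S N] stay strictly below e, as an open ball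
     requires. *)
  have e2 : 0 < complex.Re e / 4%:R by apply: divr_gt0.
  have /cvgrPdist_le /(_ _ e2)[N _ hN] := cc.
  have SN n : (N <= n)%N -> nrm (S n - S N) <= complex.Re e / 4%:R.
    move=> Nn; rewrite -(subnKC Nn); apply: le_trans (Sd _ _) _.
    apply: le_trans (hN N (leqnn _)); rewrite -/(series c N).
    apply: le_trans (ler_norm _); rewrite lerD2r.
    exact: nondecreasing_cvgn_le.
  near_simpl; exists ([set n | (N <= n)%N], [set n | (N <= n)%N]).
    by split; exists N.
  move=> [n k] /= [Nn Nk]; rewrite -ball_normE /=.
  rewrite nrmE e_re ltcR.
  have -> : S n - S k = (S n - S N) - (S k - S N) by rewrite opprB addrA subrK.
  apply: le_lt_trans (nrmB _ _) _.
  apply: le_lt_trans (lerD (SN _ Nn) (SN _ Nk)) _; lra.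
have /cvg_ex[V] : cvg (S @ \oo) by exact: cauchy_cvg.
move/nrm_cvgP => SV; exists V => N; apply/ler_addgt0Pr => e e0.
have [M hM] := SV _ e0.
have := hM (N + M)%N (leq_addl _ _).
have -> : V - \sum_(j < N) v j = (V - S (N + M)%N) + (S (N + M)%N - S N).
  by rewrite addrA subrK.
move=> h; apply: le_trans (nrmD _ _) _; rewrite addrC; apply: lerD h.
apply: le_trans (Sd _ _) _; rewrite lerD2r; exact: nondecreasing_cvgn_le.
Qed.

(** * Bounded operators, exponentials and spectra *)

Section BoundedLinear.
Variables (R : realType) (E : normedModType R[i]).
Implicit Types (S T : E -> E) (x y : E).

(** A predicate on bare functions, because [mx_op] and [op_exp] are chosen by [get] and carry no
    linear structure. *)
Definition bounded_linear T :=
  linear T /\ exists2 b : R, 0 <= b & forall x, nrm (T x) <= b * nrm x.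

Lemma linear_add T x y : linear T -> T (x + y) = T x + T y.
Proof. by move=> lT; have := lT 1 x y; rewrite !scale1r. Qed.

Lemma linear_zero T : linear T -> T 0 = 0.
Proof.
move=> lT; have := linear_add 0 0 lT.
by rewrite addr0 => /(congr1 (fun z => z - T 0)); rewrite addrK subrr.
Qed.

Lemma linear_scale T (a : R[i]) x : linear T -> T (a *: x) = a *: T x.
Proof. by move=> lT; have := lT a x 0; rewrite (linear_zero lT) !addr0. Qed.

Lemma linear_sub T x y : linear T -> T (x - y) = T x - T y.
Proof.
by move=> lT; rewrite (linear_add _ _ lT) -scaleN1r (linear_scale _ _ lT) scaleN1r.
Qed.

Lemma linear_bigsum T (J : Type) (r : seq J) (F : J -> E) :
  linear T -> T (\sum_(j <- r) F j) = \sum_(j <- r) T (F j).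
Proof.
move=> lT; elim: r => [|j r IH]; first by rewrite !big_nil (linear_zero lT).
by rewrite !big_cons (linear_add _ _ lT) IH.
Qed.

Lemma linear_iter T j : linear T -> linear (iter j T).
Proof. by move=> lT; elim: j => [|j IH] a x y //=; rewrite IH lT. Qed.

Lemma bounded_linear_add S T : bounded_linear S -> bounded_linear T ->
  bounded_linear (fun x => S x + T x).
Proof.
move=> [lS [b b0 hb]] [lT [c c0 hc]]; split.
  by move=> a x y; rewrite lS lT scalerDr addrACA.
exists (b + c); first exact: addr_ge0.
by move=> x; rewrite mulrDl; apply: le_trans (nrmD _ _) (lerD _ _).
Qed.

Lemma Re_normc_ge0 (a : R[i]) : 0 <= complex.Re `|a|.
Proof. by have := normr_ge0 a; rewrite lecE => /andP[]. Qed.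

Lemma bounded_linear_scale (a : R[i]) T :
  bounded_linear T -> bounded_linear (fun x => a *: T x).
Proof.
move=> [lT [b b0 hb]]; split.
  by move=> d x y; rewrite lT scalerDr !scalerA mulrC.
exists (complex.Re `|a| * b); first by rewrite mulr_ge0 // Re_normc_ge0.
by move=> x; rewrite nrmZ -mulrA ler_wpM2l // Re_normc_ge0.
Qed.

Lemma bounded_linear_comp S T : bounded_linear S -> bounded_linear T ->
  bounded_linear (S \o T).
Proof.
move=> [lS [b b0 hb]] [lT [c c0 hc]]; split.
  by move=> a x y /=; rewrite lT lS.
exists (b * c); first exact: mulr_ge0.
by move=> x /=; apply: le_trans (hb _) _; rewrite -mulrA ler_wpM2l.
Qed.

Lemma bounded_linear_id : bounded_linear (fun x : E => x).
Proof. by split=> //; exists 1 => // x; rewrite mul1r. Qed.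

Lemma bounded_linear_zero : bounded_linear (fun _ : E => 0 : E).
Proof.
split; first by move=> a x y; rewrite scaler0 addr0.
by exists 0 => // x; rewrite nrm0 mul0r.
Qed.

Lemma bounded_linear_iter T j : bounded_linear T -> bounded_linear (iter j T).
Proof.
move=> bT; elim: j => [|j IH]; first exact: bounded_linear_id.
exact: bounded_linear_comp bT IH.
Qed.

Lemma bounded_linear_sum (F : nat -> E -> E) k :
  (forall j, bounded_linear (F j)) ->
  bounded_linear (fun x => \sum_(j < k) F j x).
Proof.
move=> bF; elim: k => [|k IH].
  rewrite (_ : (fun _ => _) = fun=> 0); first exact: bounded_linear_zero.
  by apply/funext => x; rewrite big_ord0.
rewrite (_ : (fun _ => _) = fun x => (\sum_(j < k) F j x) + F k x).
  exact: bounded_linear_add.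
by apply/funext => x; rewrite big_ord_recr.
Qed.

Lemma iter_norm_bound T (b : R) j x : 0 <= b ->
  (forall x, nrm (T x) <= b * nrm x) -> nrm (iter j T x) <= b ^+ j * nrm x.
Proof.
move=> b0 hb; elim: j => [|j IH]; first by rewrite expr0 mul1r.
by rewrite exprS -mulrA; apply: le_trans (hb _) _; rewrite ler_wpM2l.
Qed.

Lemma nrm_smallM x (K : R) :
  0 <= K -> (forall e : R, 0 < e -> nrm x <= e * K) -> x = 0.
Proof.
move=> K0 h; apply: nrm_small => e e0.
have K1 : 0 < K + 1 by rewrite ltr_wpDl.
apply: le_trans (h (e / (K + 1)) (divr_gt0 e0 K1)) _.
rewrite mulrAC ler_pdivrMr // ler_pM2l // lerDl; exact: ler01.
Qed.

Definition op_lim (T_ : nat -> E -> E) T := forall e : R, 0 < e ->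
  exists N, forall n, (N <= n)%N -> forall x, nrm (T_ n x - T x) <= e * nrm x.

Lemma op_cvgP (T_ : nat -> E -> E) T : op_cvg T_ T <-> op_lim T_ T.
Proof.
split=> h e e0.
  have [N _ hN] := h _ e0; exists N => n Nn x.
  by rewrite -lecR rmorphM /= -!nrmE; apply: hN.
have [N hN] := h _ e0; exists N => // n Nn x.
by rewrite !nrmE -rmorphM lecR; apply: hN.
Qed.

(** The approximants are linear, so the linearity defect of T is a combination of its errors at
    three vectors. A bound for T is the bound of one approximant plus 1. *)
Lemma op_lim_bounded_linear (T_ : nat -> E -> E) T :
  (forall n, bounded_linear (T_ n)) -> op_lim T_ T -> bounded_linear T.
Proof.
move=> bT h; split.
  move=> a x y; apply/eqP; rewrite -subr_eq0; apply/eqP.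
  pose K := nrm (a *: x + y) + (complex.Re `|a| * nrm x + nrm y).
  have K0 : 0 <= K by rewrite !addr_ge0 ?mulr_ge0 ?nrm_ge0 ?Re_normc_ge0.
  apply: (nrm_smallM K0) => e e0.
  have [N /(_ N (leqnn _)) hN] := h _ e0.
  have -> : T (a *: x + y) - (a *: T x + T y) =
    (a *: (T_ N x - T x) + (T_ N y - T y)) - (T_ N (a *: x + y) - T (a *: x + y)).
    by rewrite (bT N).1 scalerBr [in RHS]addrACA -opprD opprB [RHS]addrC subrKA.
  apply: le_trans (nrmB _ _) _; rewrite addrC !mulrDr; apply: lerD => //.
  apply: le_trans (nrmD _ _) _; rewrite nrmZ; apply: lerD => //.
  by rewrite mulrCA ler_wpM2l // Re_normc_ge0.
have [N /(_ N (leqnn _)) hN] := h _ ltr01.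
have [_ [b b0 hb]] := bT N.
exists (b + 1) => [|x]; first by rewrite addr_ge0.
have -> : T x = T_ N x - (T_ N x - T x) by rewrite opprB addrC subrK.
by apply: le_trans (nrmB _ _) _; rewrite mulrDl; apply: lerD.
Qed.

Lemma continuous_of_bound (S : {linear E -> E}) (b : R) :
  (forall x, nrm (S x) <= b * nrm x) -> continuous S.
Proof.
move=> hb; apply: bounded_linear_continuous.
apply/linear_boundedP; exists b%:C; split;
  first by rewrite realE !lecE /= eqxx /= le_total.
move=> r br x; apply: (@le_trans _ _ (b%:C * `|x|)).
  by rewrite !nrmE -rmorphM lecR.
exact: ler_wpM2r (normr_ge0 _) _ _ (ltW br).
Qed.

Lemma bound_of_continuous (S : {linear E -> E}) : continuous S ->
  bounded_linear S.
Proof.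
move=> cS; split; first exact: linearP.
have /linear_bounded_continuous/linear_boundedP[M [Mr hM]] := cS.
have MRe : M = (complex.Re M)%:C.
  move: Mr; rewrite realE !lecE; case: M {hM} => a b /=.
  by case/orP=> /andP[/eqP b0 _]; [rewrite b0 | rewrite -b0].
(* The bound is granted only for constants strictly above M, and M may be negative. *)
exists (Num.max 0 (complex.Re M) + 1) => [|x].
  by rewrite addr_ge0 // le_max lexx.
rewrite -lecR rmorphM /= -!nrmE; apply: hM.
by rewrite MRe ltcR ltr_pwDr // le_max lexx orbT.
Qed.

End BoundedLinear.

(** * Operator series: the exponential and the Neumann series *)

Section Resolvents.
Variables (R : realType) (E : completeNormedModType R[i]).
Implicit Types (S T Q : E -> E) (x y : E).

Lemma op_series_ex (F : nat -> E -> E) (c : nat -> R) :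
  (forall n x, nrm (F n x) <= c n * nrm x) -> (forall n, 0 <= c n) ->
  cvgn (series c) -> exists S, op_lim (fun N x => \sum_(j < N) F j x) S.
Proof.
move=> Fc c0 cc.
have V x : exists V, forall N, nrm (V - \sum_(j < N) F j x) <=
    (limn (series c) - series c N) * nrm x.
  have [||V hV] := @summable_sum R E (fun j => F j x) (fun j => c j * nrm x).
  - by move=> n; exact: Fc.
  - have -> : (fun j => c j * nrm x) = nrm x *: c.
      by apply/funext => j; rewrite mulrC.
    exact: is_cvg_seriesZ.
  - exists V => N; apply: le_trans (hV N) _.
    have -> : (fun j => c j * nrm x) = nrm x *: c.
      by apply/funext => j; rewrite mulrC.
    by rewrite lim_seriesZ // seriesZ mulrBl lerB // /= mulrC.
have [S hS] := choice V; exists S => e e0.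
have /cvgrPdist_le /(_ _ e0)[N _ hN] := cc.
exists N => n Nn x; rewrite nrm_distC; apply: le_trans (hS x n) _.
apply: ler_wpM2r; first exact: nrm_ge0.
by apply: le_trans (ler_norm _) _; apply: hN.
Qed.

Definition exp_partial T k x := \sum_(j < k) (j`!%:R^-1 : R)%:C *: iter j T x.

Lemma bounded_linear_exp_partial T k :
  bounded_linear T -> bounded_linear (exp_partial T k).
Proof.
move=> bT.
apply: (bounded_linear_sum (F := fun j x => (j`!%:R^-1 : R)%:C *: iter j T x)).
by move=> j; apply: bounded_linear_scale; apply: bounded_linear_iter.
Qed.

(** [op_exp] is a choice from the set of limits; comparison with the real exponential series of a
    bound of T shows that this set is inhabited. *)
Lemma op_exp_lim T : bounded_linear T -> op_lim (exp_partial T) (op_exp T).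
Proof.
move=> bT; have [lT [b b0 hb]] := bT.
have [|||S hS] := @op_series_ex (fun j x => (j`!%:R^-1 : R)%:C *: iter j T x)
   (exp_coeff b).
- move=> n x; rewrite nrmZp ?invr_ge0 // exp_coeffE /= -mulrA ler_wpM2l //.
  exact: iter_norm_bound.
- by move=> n; exact: exp_coeff_ge0.
- exact: is_cvg_series_exp_coeff.
apply/op_cvgP.
have -> : exp_partial T =
    (fun k x => \sum_(j < k) (j`!%:R^-1 : R[i]) *: iter j T x).
  apply/funext => k; apply/funext => x; apply: eq_bigr => j _.
  by rewrite fmorphV rmorph_nat.
apply: (@getPex _ [set S | op_cvg
  (fun k x => \sum_(j < k) (j`!%:R^-1 : R[i]) *: iter j T x) S]).
exists S; apply/op_cvgP.
move: hS; rewrite (_ : (fun N x => _) = (fun k x =>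
   \sum_(j < k) (j`!%:R^-1 : R[i]) *: iter j T x)) //.
apply/funext => k; apply/funext => x; apply: eq_bigr => j _.
by rewrite fmorphV rmorph_nat.
Qed.

Lemma op_exp_bounded_linear T : bounded_linear T -> bounded_linear (op_exp T).
Proof.
move=> bT; apply: op_lim_bounded_linear (op_exp_lim bT) => k.
exact: bounded_linear_exp_partial.
Qed.

(* Neumann series: the inverse of l - Q is the sum of the Q^k / l^(k+1). *)
Lemma spectrum_le Q (c r : R) l : bounded_linear Q -> 0 <= r -> 0 <= c ->
  (forall k x, nrm (iter k Q x) <= c * r ^+ k * nrm x) ->
  spectrum Q l -> complex.Re `|l| <= r.
Proof.
move=> bQ r0 c0 hQ; apply: contraPP => /negP; rewrite -ltNge => rl.
have [lQ [b b0 hb]] := bQ.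
set a := complex.Re `|l| in rl.
have a0 : 0 < a by exact: le_lt_trans rl.
have l0 : l != 0.
  by apply: contraTneq a0 => h; rewrite /a h normr0 ltxx.
have invl n : complex.Re `|l ^- n| = a ^- n.
  by rewrite normfV normrX normc_Re -rmorphXn -fmorphV.
pose F n x := l ^- n.+1 *: iter n Q x.
have bF n : bounded_linear (F n).
  by apply: bounded_linear_scale; exact: bounded_linear_iter.
have q1 : `|r / a| < 1 by rewrite ger0_norm ?divr_ge0 ?(ltW a0) // ltr_pdivrMr // mul1r.
have Fc n x : nrm (F n x) <= geometric (c / a) (r / a) n * nrm x.
  rewrite /F nrmZ invl /= exprMn exprVn exprS invfM.
  have -> : c / a * (r ^+ n / a ^+ n) * nrm x =
    a^-1 / a ^+ n * (c * r ^+ n * nrm x).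
    by ring.
  by apply: ler_wpM2l (hQ _ _); rewrite mulr_ge0 ?invr_ge0 ?exprn_ge0 ?(ltW a0).
have F0 n : 0 <= geometric (c / a) (r / a) n.
  by rewrite /= mulr_ge0 ?exprn_ge0 ?divr_ge0 ?(ltW a0).
have [S hS] := op_series_ex Fc F0 (is_cvg_geometric_series q1).
have bS : bounded_linear S.
  by apply: op_lim_bounded_linear hS => n; exact: bounded_linear_sum.
(* Applying l - Q to a partial sum telescopes; the remainder Q^N x / l^N tends to 0 since r <
   |l|. *)
have tele N x : l *: (\sum_(j < N) F j x) - \sum_(j < N) Q (F j x)
    = x - l ^- N *: iter N Q x.
  elim: N => [|N IH].
    by rewrite !big_ord0 scaler0 subr0 expr0 invr1 scale1r subrr.
  rewrite !big_ord_recr /= scalerDr opprD addrACA IH /F (linear_scale _ _ lQ).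
  rewrite scalerA exprS invfM mulrA mulfV // mul1r addrA subrK; congr (_ - _).
have QS N x : Q (\sum_(j < N) F j x) = \sum_(j < N) Q (F j x).
  exact: linear_bigsum.
have SQ N x : \sum_(j < N) F j (Q x) = \sum_(j < N) Q (F j x).
  by apply: eq_bigr => j _; rewrite /F (linear_scale _ _ lQ) -iterSr.
have small e : 0 < e -> exists N, forall n, (N <= n)%N ->
    forall x, nrm (l ^- n *: iter n Q x) <= e * nrm x.
  move=> e0.
  have /cvgrPdist_le /(_ e e0)[N _ hN] := @cvg_geometric R c _ q1.
  exists N => n Nn x; apply: (@le_trans _ _ (geometric c (r / a) n * nrm x)).
    rewrite nrmZ invl /= exprMn exprVn.
    have -> : c * (r ^+ n / a ^+ n) * nrm x = (a ^+ n)^-1 * (c * r ^+ n * nrm x).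
      by ring.
    by apply: ler_wpM2l (hQ _ _); rewrite invr_ge0 exprn_ge0 ?(ltW a0).
  apply: ler_wpM2r; first exact: nrm_ge0.
  have := hN n Nn; rewrite /= sub0r normrN; exact: le_trans (ler_norm _).
have [lS _] := bS.
have inv1 x : l *: S x - Q (S x) = x.
  apply/eqP; rewrite -subr_eq0; apply/eqP.
  pose K := (a + b + 1) * nrm x.
  have K0 : 0 <= K by rewrite mulr_ge0 ?nrm_ge0 // !addr_ge0 // ltW.
  apply: (nrm_smallM K0) => e e0.
  have [N hN] := hS _ e0; have [M hM] := small _ e0.
  have {}hN := hN (maxn N M) (leq_maxl _ _) x.
  have {}hM := hM (maxn N M) (leq_maxr _ _) x.
  set V := (\sum_(j < maxn N M) F j x) in hN.
  have -> : l *: S x - Q (S x) - x = Q (V - S x) - l *: (V - S x)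
      - l ^- (maxn N M) *: iter (maxn N M) Q x.
    have := tele (maxn N M) x; rewrite -QS -/V => h.
    rewrite (linear_sub _ _ lQ) scalerBr.
    rewrite -[X in _ - X = _](subrK (l ^- (maxn N M) *: iter (maxn N M) Q x) x) -h.
    by rewrite opprD addrA !opprB addrACA [l *: S x + _]addrC addrACA.
  apply: le_trans (nrmB _ _) _; rewrite /K.
  have -> : e * ((a + b + 1) * nrm x) =
    (b * (e * nrm x) + a * (e * nrm x)) + e * nrm x.
    by ring.
  apply: lerD => //; apply: le_trans (nrmB _ _) _; apply: lerD.
    by apply: le_trans (hb _) _; rewrite ler_wpM2l.
  by rewrite nrmZ ler_wpM2l // ltW.
(* By [inv1] it suffices that S and Q commute, which holds for every partial sum. *)
have inv2 x : S (l *: x - Q x) = x.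
  rewrite (linear_sub _ _ lS) (linear_scale _ _ lS).
  rewrite -[RHS]inv1; congr (_ - _); apply/eqP; rewrite -subr_eq0; apply/eqP.
  pose K := nrm (Q x) + b * nrm x.
  have K0 : 0 <= K by rewrite addr_ge0 ?mulr_ge0 ?nrm_ge0.
  apply: (nrm_smallM K0) => e e0.
  have [N /(_ N (leqnn _)) hN] := hS _ e0.
  have -> : S (Q x) - Q (S x) =
    Q (\sum_(j < N) F j x - S x) - (\sum_(j < N) F j (Q x) - S (Q x)).
    rewrite (linear_sub _ _ lQ) QS SQ opprB [RHS]addrC addrA subrK.
    by [].
  apply: le_trans (nrmB _ _) _; rewrite addrC mulrDr; apply: lerD => //.
  by apply: le_trans (hb _) _; rewrite mulrCA ler_wpM2l.
apply; pose S' := GRing.isLinear.Build _ _ _ _ S lS.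
pose SL : {linear E -> E} := HB.pack S S'.
exists SL; split => //.
have [b' b'0 hb'] := bS.2.
exact: (@continuous_of_bound _ _ SL b').
Qed.

Lemma spectrum_bounded Q (b : R) l : bounded_linear Q -> 0 <= b ->
  (forall x, nrm (Q x) <= b * nrm x) -> spectrum Q l -> complex.Re `|l| <= b.
Proof.
move=> bQ b0 hb; apply: (@spectrum_le Q 1 b l) => // k x.
by rewrite mul1r; exact: iter_norm_bound.
Qed.

Lemma spectral_radius_le Q (c r : R) : bounded_linear Q -> 0 <= r -> 0 <= c ->
  (forall k x, nrm (iter k Q x) <= c * r ^+ k * nrm x) ->
  spectral_radius Q <= r.
Proof.
move=> bQ r0 c0 hQ; rewrite /spectral_radius.
have ubr : ubound [set complex.Re `|l| | l in spectrum Q] r.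
  by move=> _ [l hl <-]; exact: spectrum_le hQ hl.
(* On the empty set [sup] is 0 by convention, and 0 <= r. *)
have [->|/set0P ne] := eqVneq [set complex.Re `|l| | l in spectrum Q] set0.
  by rewrite sup0.
exact: ge_sup.
Qed.

Lemma resolvent_ex Q (t : R) : bounded_linear Q -> spectral_radius Q < t ->
  exists S, [/\ bounded_linear S, forall x, S (t%:C *: x - Q x) = x
    & forall x, t%:C *: S x - Q (S x) = x].
Proof.
move=> bQ qt; have [_ [b b0 hb]] := bQ.
(* A spectral value t would be at most the supremum; [sup] is an actual upper bound because the
   spectrum is bounded by b. *)
have : ~ spectrum Q t%:C.
  move=> ht; move: qt; rewrite ltNge => /negP; apply.
  apply: (@le_trans _ _ (complex.Re `|t%:C|)); first by rewrite normcR ler_norm.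
  apply: ub_le_sup; last by exists t%:C.
  by exists b => _ [l hl <-]; exact: spectrum_bounded hl.
rewrite /spectrum /= => /contrapT[S [cS S1 S2]].
by exists S; split => //; exact: bound_of_continuous.
Qed.

End Resolvents.

(** * Sums over the index set *)

(** Listing the summed indices lets the finite and the infinite index set share all later arguments
    on partial sums. *)
Definition first_idx (I : index_set) (k : nat) : seq (idx I) :=
  match I return seq (idx I) with
  | Initial n => [seq i : 'I_n.+1 <- enum 'I_n.+1 | (i < k)%N]
  | AllNat => iota 0 k
  end.

Lemma partial_sumE (V : nmodType) (I : index_set) (f : idx I -> V) k :
  partial_sum f k = \sum_(j <- first_idx I k) f j.
Proof.
case: I f => [n|] f /=; first by rewrite big_filter big_enum_cond /=;
  exact: eq_bigl.
by rewrite -(big_mkord xpredT f) /index_iota subn0.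
Qed.

Lemma first_idx_uniq I k : uniq (first_idx I k).
Proof.
by case: I => [n|] /=; [rewrite filter_uniq ?enum_uniq | exact: iota_uniq].
Qed.

Lemma first_idx_sub I k l : (k <= l)%N -> {subset first_idx I k <= first_idx I l}.
Proof.
move=> kl; case: I => [n|] j /=; last first.
  by rewrite !mem_iota !add0n /= => jk; exact: leq_trans jk kl.
by rewrite !mem_filter => /andP[jk ->]; rewrite (leq_trans jk kl).
Qed.

Lemma first_idx_mem I (j : idx I) :
  exists K, forall k, (K <= k)%N -> j \in first_idx I k.
Proof.
case: I j => [n|] j; exists j.+1 => k jk; last by rewrite mem_iota add0n.
by rewrite mem_filter jk mem_enum.
Qed.

Section RealSums.
Variables (R : realType) (I : index_set).
Implicit Types (f g : idx I -> R).

Definition psum f (s : R) := partial_sum f @ \oo --> s.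

Lemma partial_sum_ge0 f k : (forall j, 0 <= f j) -> 0 <= partial_sum f k.
Proof. by move=> f0; rewrite partial_sumE sumr_ge0. Qed.

Lemma partial_sum_le f g k :
  (forall j, f j <= g j) -> partial_sum f k <= partial_sum g k.
Proof. by move=> fg; rewrite !partial_sumE ler_sum. Qed.

Lemma partial_sum_homo f : (forall j, 0 <= f j) ->
  {homo partial_sum f : k l / (k <= l)%N >-> k <= l}.
Proof.
move=> f0 k l kl; rewrite !partial_sumE.
rewrite [leRHS](bigID (mem (first_idx I k))) /=.
rewrite -[X in _ <= X + _]big_filter.
have -> : \sum_(j <- [seq j <- first_idx I l | j \in first_idx I k]) f j
    = \sum_(j <- first_idx I k) f j.
  apply: perm_big; apply: uniq_perm => [||j].
  - by rewrite filter_uniq ?first_idx_uniq.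
  - exact: first_idx_uniq.
  - rewrite mem_filter; case jk: (j \in first_idx I k) => //=.
    exact: first_idx_sub jk.
by rewrite lerDl sumr_ge0.
Qed.

Lemma psum_uniq f s t : psum f s -> psum f t -> s = t.
Proof. exact: (cvg_unique (@Rhausdorff R)). Qed.

Lemma psum_lim f s : psum f s -> limn (partial_sum f) = s.
Proof. exact: (cvg_lim (@Rhausdorff R)). Qed.

Lemma psum_ge f s k : (forall j, 0 <= f j) -> psum f s -> partial_sum f k <= s.
Proof.
move=> f0 fs; rewrite -(psum_lim fs); apply: nondecreasing_cvgn_le.
  exact: partial_sum_homo.
by apply/cvg_ex; exists s.
Qed.

Lemma psum_le_of f s M : psum f s -> (forall k, partial_sum f k <= M) -> s <= M.
Proof. by move=> fs fM; apply: cvgr_to_le fs _; apply: nearW. Qed.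

Lemma psum_bounded f M : (forall j, 0 <= f j) ->
  (forall k, partial_sum f k <= M) -> exists2 s, psum f s & s <= M.
Proof.
move=> f0 fM.
have fc : cvgn (partial_sum f).
  apply: nondecreasing_is_cvgn; first exact: partial_sum_homo.
  by exists M => _ [k _ <-].
by exists (limn (partial_sum f)) => //; exact: psum_le_of fc fM.
Qed.

Lemma psum_dominated f g t : (forall j, 0 <= f j) -> (forall j, f j <= g j) ->
  psum g t -> exists2 s, psum f s & s <= t.
Proof.
move=> f0 fg gt; apply: psum_bounded => // k.
apply: le_trans (partial_sum_le k fg) _; apply: psum_ge gt => j.
exact: le_trans (f0 j) (fg j).
Qed.

Lemma psum_le f g s t : (forall j, f j <= g j) -> psum f s -> psum g t -> s <= t.
Proof.
move=> fg fs gt; rewrite -(psum_lim fs) -(psum_lim gt).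
apply: ler_lim; [by apply/cvg_ex; exists s|by apply/cvg_ex; exists t|].
by apply: nearW => k; exact: partial_sum_le.
Qed.

Lemma psum_ge0 f s : (forall j, 0 <= f j) -> psum f s -> 0 <= s.
Proof.
by move=> f0 fs; apply: le_trans (psum_ge 0 f0 fs); exact: partial_sum_ge0.
Qed.

Lemma psumZ (a : R) f s : psum f s -> psum (fun j => a * f j) (a * s).
Proof.
move=> fs; rewrite /psum.
have -> : partial_sum (fun j => a * f j) = (fun k => a * partial_sum f k).
  by apply/funext => k; rewrite !partial_sumE big_distrr.
exact: cvgMr.
Qed.

Lemma psum_delta f j : psum (fun k => f k * (k == j)%:R) (f j).
Proof.
have [K hK] := first_idx_mem j.
apply: cvg_near_cst; exists K => // k Kk.
rewrite partial_sumE (bigD1_seq j) ?first_idx_uniq ?hK //= eqxx mulr1.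
by rewrite big1 ?addr0 // => l /negbTE ->; rewrite mulr0.
Qed.

(** Finitely many columns can be summed before the limit over rows is taken; exchanging two finite
    sums then bounds the result by a partial sum of g, hence by s. *)
Lemma psum_tonelli_le (f : idx I -> idx I -> R) g s :
  (forall k j, 0 <= f k j) -> (forall k, psum (f k) (g k)) -> psum g s ->
  exists h, (forall j, psum (f^~ j) (h j)) /\ exists2 t, psum h t & t <= s.
Proof.
move=> f0 fg gs.
have g0 k : 0 <= g k by exact: psum_ge0 (fg k).
have fle k j : f k j <= g k.
  have [K /(_ K (leqnn _)) jK] := first_idx_mem j.
  apply: le_trans (psum_ge K (f0 k) (fg k)).
  by rewrite partial_sumE (bigD1_seq j) ?first_idx_uniq //= lerDl sumr_ge0.
have /choice[h hh] j : exists t, psum (f^~ j) t.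
  by have [t ft _] := psum_dominated (f0^~ j) (fle^~ j) gs; exists t.
exists h; split => //.
apply: psum_bounded => [j|n]; first exact: psum_ge0 (hh j).
have cv : (fun K => \sum_(j <- first_idx I n) partial_sum (f^~ j) K) @ \oo -->
    \sum_(j <- first_idx I n) h j.
  elim: (first_idx I n) => [|j r IH].
    rewrite big_nil; apply: cvg_near_cst; apply: nearW => K; by rewrite big_nil.
  rewrite big_cons.
  rewrite (_ : (fun K => _) = (fun K => partial_sum (f^~ j) K +
      \sum_(j <- r) partial_sum (f^~ j) K)).
    by apply: cvgD => //; exact: hh.
  by apply/funext => K; rewrite big_cons.
rewrite partial_sumE; apply: cvgr_to_le cv _; apply: nearW => K.
apply: le_trans (psum_ge K g0 gs).
under eq_bigr do rewrite partial_sumE.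
rewrite exchange_big /= [leRHS]partial_sumE; apply: ler_sum => k _.
by rewrite -partial_sumE; exact: psum_ge (fg k).
Qed.

(** The one-sided version is applied to f and then to its transpose, so each iterated sum is at most
    the other. *)
Lemma psum_tonelli (f : idx I -> idx I -> R) g s :
  (forall k j, 0 <= f k j) -> (forall k, psum (f k) (g k)) -> psum g s ->
  exists h, (forall j, psum (f^~ j) (h j)) /\ psum h s.
Proof.
move=> f0 fg gs; have [h [hf [t ht ts]]] := psum_tonelli_le f0 fg gs.
exists h; split => //.
have [g' [g'f [s' s'g' s't]]] := psum_tonelli_le (fun j k => f0 k j) hf ht.
have gg' : g' = g by apply/funext => k; apply: psum_uniq (fg k); exact: g'f.
have ss' : s' = s by apply: psum_uniq gs; rewrite -gg'.
suff -> : s = t by [].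
by apply/eqP; rewrite eq_le ts -ss' s't.
Qed.

(** A nonnegative term is at most its own sum, so the first factor can be pulled out as [s ord0],
    and induction treats the rest. *)
Lemma psum_prod m (f : 'I_m.+1 -> idx I -> R) (s : 'I_m.+1 -> R) k :
  (forall i j, 0 <= f i j) -> (forall i, psum (f i) (s i)) ->
  partial_sum (fun j => \prod_i f i j) k <= \prod_i s i.
Proof.
elim: m f s => [|m IH] f s f0 fs.
  have -> : (fun j => \prod_i f i j) = f ord0.
    by apply/funext => j; rewrite big_ord1.
  by rewrite big_ord1; exact: psum_ge.
rewrite big_ord_recl.
apply: (@le_trans _ _ (partial_sum (fun j => s ord0 *
    \prod_(i < m.+1) f (lift ord0 i) j) k)).
  apply: partial_sum_le => j /=; rewrite [leLHS]big_ord_recl; apply: ler_pM => //.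
    by apply: prodr_ge0 => i _.
  have [K /(_ K (leqnn _)) jK] := first_idx_mem j.
  apply: le_trans (psum_ge K (f0 ord0) (fs ord0)).
  by rewrite partial_sumE (bigD1_seq j) ?first_idx_uniq //= lerDl sumr_ge0.
rewrite partial_sumE -big_distrr -partial_sumE /=; apply: ler_wpM2l.
  exact: psum_ge0 (fs ord0).
exact: IH.
Qed.

End RealSums.

(** * Complex series with real terms *)

Section ComplexSums.
Variables (R : realType) (I : index_set).

Lemma real_part_le (c : R[i]) : `|complex.Re c| <= nrm (c : R[i]^o).
Proof. by rewrite -lecR -nrmE; exact: normc_ge_Re. Qed.

Lemma imag_part_le (c : R[i]) : `|complex.Im c| <= nrm (c : R[i]^o).
Proof.
have := real_part_le (c * 'i%C); rewrite ReiNIm normrN => h.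
apply: le_trans h _; rewrite /nrm normrM (_ : `|'i%C| = 1 :> R[i]) ?mulr1 //.
by rewrite normc_def /= expr0n expr1n add0r sqrtr1.
Qed.

Lemma csum_real (f : idx I -> R) (c : R[i]^o) :
  (partial_sum (fun j => (f j)%:C : R[i]^o) @ \oo --> c) <->
  c = (complex.Re c)%:C /\ psum f (complex.Re c).
Proof.
have psC k : partial_sum (fun j => (f j)%:C : R[i]^o) k = (partial_sum f k)%:C.
  by rewrite !partial_sumE rmorph_sum.
split=> [/nrm_cvgP h|[-> /cvgrPdist_le h]].
  have Re_eq (x y : R[i]) : complex.Re (x - y) = complex.Re x - complex.Re y.
    by case: x y => ? ? [].
  have Im_eq (x y : R[i]) : complex.Im (x - y) = complex.Im x - complex.Im y.
    by case: x y => ? ? [].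
  split.
    have : complex.Im c = 0.
      apply/eqP; rewrite -normr_eq0 eq_le normr_ge0 andbT.
      apply/ler_addgt0Pr => e e0; rewrite add0r.
      have [N /(_ N (leqnn _)) hN] := h _ e0.
      apply: le_trans hN; apply: le_trans (imag_part_le _).
      by rewrite psC Im_eq /= subr0.
    by case: (c) => a b /= ->.
  apply/cvgrPdist_le => e e0; have [N hN] := h _ e0; exists N => // n Nn.
  apply: le_trans (hN n Nn); apply: le_trans (real_part_le _).
  by rewrite psC Re_eq.
apply/nrm_cvgP => e e0; have [N _ hN] := h _ e0; exists N => n Nn.
by rewrite psC -rmorphB /nrm normcR; exact: hN.
Qed.

End ComplexSums.

(** * Matrix operators on a Banach sequence space *)

Section SequenceSpace.
Variables (R : realType) (I : index_set) (L : banachSeqSpace R I).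
Implicit Types (x y z : L) (M A B : imatrix R I).

Definition coord x j : R := complex.Re (bcoords x j).

Definition pos x := forall j, (0 : R[i]) <= bcoords x j.

Definition dom x y := forall j, nrm (bcoords x j) <= coord y j.

Lemma bcoordsD x y j : bcoords (x + y) j = bcoords x j + bcoords y j.
Proof. by rewrite linearD. Qed.

Lemma bcoordsB x y j : bcoords (x - y) j = bcoords x j - bcoords y j.
Proof. by rewrite linearB. Qed.

Lemma bcoordsZ (a : R[i]) x j : bcoords (a *: x) j = a * bcoords x j.
Proof. by rewrite linearZ. Qed.

Lemma bcoords0 j : bcoords (0 : L) j = 0.
Proof. by rewrite linear0. Qed.

Lemma coordB x y j : coord (x - y) j = coord x j - coord y j.
Proof. by rewrite /coord bcoordsB; case: (bcoords x j) (bcoords y j) => ? ? []. Qed.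

Lemma coordZ (a : R) x j : coord (a%:C *: x) j = a * coord x j.
Proof.
by rewrite /coord bcoordsZ; case: (bcoords x j) => b c /=; rewrite mul0r subr0.
Qed.

Lemma posP x : pos x <-> forall j, bcoords x j = (coord x j)%:C /\ 0 <= coord x j.
Proof.
split=> px j; last by have [-> ?] := px j; rewrite ler0c.
have := px j; rewrite /coord; case: (bcoords x j) => a b.
by rewrite lecE /= => /andP[/eqP -> ->].
Qed.

Lemma pos_real x j : pos x -> bcoords x j = (coord x j)%:C.
Proof. by case/posP/(_ j). Qed.

Lemma pos_coord_ge0 x j : pos x -> 0 <= coord x j.
Proof. by case/posP/(_ j). Qed.

Lemma pos_nrm_bcoords x j : pos x -> nrm (bcoords x j) = coord x j.
Proof.
by case/posP/(_ j) => -> x0; rewrite /nrm normcR ger0_norm.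
Qed.

Lemma pos0 : pos 0.
Proof. by move=> j; rewrite bcoords0. Qed.

Lemma posD x y : pos x -> pos y -> pos (x + y).
Proof. by move=> px py j; rewrite bcoordsD addr_ge0 // ?px ?py. Qed.

Lemma posZ (a : R) x : 0 <= a -> pos x -> pos (a%:C *: x).
Proof. by move=> a0 px j; rewrite bcoordsZ mulr_ge0 ?ler0c // px. Qed.

Lemma pos_sum k (F : nat -> L) : (forall j, pos (F j)) -> pos (\sum_(j < k) F j).
Proof. by move=> h; elim/big_ind: _ => // [|x y]; [exact: pos0|exact: posD]. Qed.

Lemma solid (u : complex_seq R I) y :
  (forall j, nrm (u j) <= nrm (bcoords y j)) ->
  exists2 z : L, bcoords z = u & nrm z <= nrm y.
Proof.
move=> h; have [|z zu zy] := @bspace_solid _ _ L u y.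
  by move=> j; rewrite !nrmE lecR.
by exists z => //; rewrite nrm_le.
Qed.

Lemma solid_pos (u : idx I -> R) y :
  (forall j, 0 <= u j <= nrm (bcoords y j)) ->
  exists z, [/\ pos z, forall j, coord z j = u j & nrm z <= nrm y].
Proof.
move=> h; have [|z zu zy] := @solid (fun j => (u j)%:C) y.
  by move=> j; have /andP[u0 uy] := h j; rewrite /nrm normcR ger0_norm.
exists z; split => // j; last by rewrite /coord zu.
by rewrite zu ler0c; case/andP: (h j).
Qed.

Lemma abs_ex x : exists p, [/\ pos p, dom x p & nrm p <= nrm x].
Proof.
have [|p [pp px np]] := @solid_pos (fun j => nrm (bcoords x j)) x.
  by move=> j; rewrite nrm_ge0 lexx.
by exists p; split => // j; rewrite px.
Qed.

Lemma dom_nrm x y : pos y -> dom x y -> nrm x <= nrm y.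
Proof.
move=> py xy; have [|z zx zy] := @solid (bcoords x) y.
  by move=> j; apply: le_trans (xy j) _; rewrite pos_nrm_bcoords.
by rewrite -(bcoords_inj zx).
Qed.

(** Solidity puts the positive and negative parts of Re x and Im x in L. Existence of images thus
    reduces to positive vectors, whose row series are real and monotone. *)
Lemma pos_decomp x : exists p q r s,
  [/\ pos p, pos q, pos r & pos s] /\ x = (p - q) + 'i%C *: (r - s).
Proof.
have part (f : R[i] -> R) : (forall c, `|f c| <= nrm (c : R[i]^o)) ->
    exists p q, [/\ pos p, pos q & forall j, coord p j - coord q j =
      f (bcoords x j)].
  move=> hf.
  have [|p [pp hp _]] := @solid_pos (fun j => Num.max (f (bcoords x j)) 0) x.
    move=> j; rewrite le_max lexx orbT ge_max nrm_ge0 andbT.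
    exact: le_trans (ler_norm _) (hf _).
  have [|q [pq hq _]] := @solid_pos (fun j => Num.max (- f (bcoords x j)) 0) x.
    move=> j; rewrite le_max lexx orbT ge_max nrm_ge0 andbT.
    by apply: le_trans (hf _); rewrite -normrN ler_norm.
  exists p, q; split => // j; rewrite hp hq /Num.max.
  case: (ltrP (f (bcoords x j)) 0) => h1; case: (ltrP _ 0) => h2; lra.
have [p [q [pp pq hpq]]] := part _ (@real_part_le R).
have [r [s [pr ps hrs]]] := part _ (@imag_part_le R).
exists p, q, r, s; split => //; apply: bcoords_inj; apply/funext => j.
rewrite bcoordsD bcoordsZ !bcoordsB (pos_real _ pp) (pos_real _ pq) (pos_real _ pr).
by rewrite (pos_real _ ps) [LHS]complexE -hpq -hrs !rmorphB.
Qed.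

Lemma coord_le_nrmb x j : `|coord x j| <= nrm (bcoords x j).
Proof. exact: real_part_le. Qed.

(** The graph of M as a relation: unlike [mx_op], it is meaningful before M is known to define an
    operator. *)
Definition mx_image M x y := forall i,
  partial_sum (mx_term M (bcoords x) i) @ \oo --> (bcoords y i : R[i]^o).

Definition pos_image M x y := forall i,
  psum (fun j => M i j * coord x j) (coord y i).

Lemma mx_image_linear M (a : R[i]) x x' y y' :
  mx_image M x x' -> mx_image M y y' -> mx_image M (a *: x + y) (a *: x' + y').
Proof.
move=> hx hy i; rewrite bcoordsD bcoordsZ.
have -> : partial_sum (mx_term M (bcoords (a *: x + y)) i) = fun k =>
    a *: (partial_sum (mx_term M (bcoords x) i) k : R[i]^o) +
    (partial_sum (mx_term M (bcoords y) i) k : R[i]^o).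
  apply/funext => k; rewrite !partial_sumE scaler_sumr -big_split /=.
  apply: eq_bigr => j _; rewrite /mx_term bcoordsD bcoordsZ mulrDr.
  by rewrite mulrCA.
apply: cvgD; last exact: hy.
by apply: cvgZr; exact: hx.
Qed.

Lemma mx_image_uniq M x y y' : mx_image M x y -> mx_image M x y' -> y = y'.
Proof.
move=> h h'; apply: bcoords_inj; apply/funext => i.
exact: (cvg_unique (@norm_hausdorff _ (R[i]^o)) (h i) (h' i)).
Qed.

Lemma mx_image_pos M x y : nonneg_mx M -> pos x ->
  mx_image M x y <-> pos y /\ pos_image M x y.
Proof.
move=> M0 px.
have E i : mx_term M (bcoords x) i = fun j => (M i j * coord x j)%:C.
  by apply/funext => j; rewrite /mx_term pos_real // rmorphM.
split=> [h|[py h] i]; last first.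
  by rewrite E; apply/csum_real; rewrite pos_real.
have h' i : bcoords y i =
  (coord y i)%:C /\ psum (fun j => M i j * coord x j) (coord y i).
  by apply/csum_real; rewrite -E; exact: h.
split=> i; last exact: (h' i).2.
rewrite (h' i).1 ler0c; apply: psum_ge0 (h' i).2 => j.
by rewrite mulr_ge0 ?pos_coord_ge0.
Qed.

Lemma defines_operatorP M :
  defines_operator L M <-> forall x, exists y, mx_image M x y.
Proof.
split=> h x.
  have [hc [y hy]] := h x; exists y => i.
  by rewrite hy /mx_apply; exact: hc.
have [y hy] := h x; split.
  by move=> i; apply/cvg_ex; exists (bcoords y i); exact: hy.
exists y; apply/funext => i; rewrite /mx_apply; apply/esym.
exact: (cvg_lim (@norm_hausdorff _ (R[i]^o)) (hy i)).
Qed.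

Lemma defines_operator_pos M : nonneg_mx M ->
  (forall x, pos x -> exists2 y, pos y & pos_image M x y) ->
  defines_operator L M.
Proof.
move=> M0 h; have {}h x : pos x -> exists y, mx_image M x y.
  by move=> px; have [y py xy] := h _ px; exists y; apply/mx_image_pos.
apply/defines_operatorP => x.
have [p [q [r [s [[pp pq pr ps] ->]]]]] := pos_decomp x.
have [p' hp] := h _ pp; have [q' hq] := h _ pq.
have [r' hr] := h _ pr; have [s' hs] := h _ ps.
exists ('i%C *: ((-1) *: s' + r') + ((-1) *: q' + p')).
rewrite addrC -(scaleN1r q) -(scaleN1r s) (addrC p) (addrC r).
by do !apply: mx_image_linear.
Qed.

Lemma mx_op_image M x : defines_operator L M -> mx_image M x (mx_op L M x).
Proof.
move=> hM; have [hc [y hy]] := hM x.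
have := @getPex _ [set y : L | bcoords y = mx_apply M (bcoords x)]
  (ex_intro _ y hy).
rewrite -/(mx_op L M x) /= => e i; rewrite e; exact: hc.
Qed.

Lemma mx_op_eq M x y : defines_operator L M -> mx_image M x y -> mx_op L M x = y.
Proof. by move=> hM; apply: mx_image_uniq; exact: mx_op_image. Qed.

Lemma mx_op_linear M : defines_operator L M -> linear (mx_op L M).
Proof.
move=> hM a x y; apply: mx_op_eq => //.
by apply: mx_image_linear; exact: mx_op_image.
Qed.

Lemma mx_op_pos_image M x : nonneg_mx M -> defines_operator L M -> pos x ->
  pos (mx_op L M x) /\ pos_image M x (mx_op L M x).
Proof. by move=> M0 hM px; apply/mx_image_pos => //; exact: mx_op_image. Qed.

Lemma mx_op_pos M x : nonneg_mx M -> defines_operator L M -> pos x ->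
  pos (mx_op L M x).
Proof. by move=> M0 hM px; have [] := mx_op_pos_image M0 hM px. Qed.

Lemma mx_op_pos_eq M x y : nonneg_mx M -> defines_operator L M -> pos x ->
  pos y -> pos_image M x y -> mx_op L M x = y.
Proof. by move=> M0 hM px py h; apply: mx_op_eq => //; apply/mx_image_pos. Qed.

Lemma mx_op_mono M x y : nonneg_mx M -> defines_operator L M ->
  pos x -> pos y -> (forall j, coord x j <= coord y j) ->
  forall i, coord (mx_op L M x) i <= coord (mx_op L M y) i.
Proof.
move=> M0 hM px py xy i.
apply: psum_le ((mx_op_pos_image M0 hM px).2 i) ((mx_op_pos_image M0 hM py).2 i).
by move=> j; exact: ler_wpM2l.
Qed.

(** The triangle inequality on a partial sum, up to an arbitrary error e. It reduces norm estimates
    to positive vectors. *)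
Lemma mx_op_dom M x y : nonneg_mx M -> defines_operator L M -> pos y ->
  dom x y -> dom (mx_op L M x) (mx_op L M y).
Proof.
move=> M0 hM py xy i.
have /nrm_cvgP hx := mx_op_image hM (x := x) (i := i).
have [_ /(_ i) hy] := mx_op_pos_image M0 hM py.
have c0 j : 0 <= M i j * coord y j by rewrite mulr_ge0 ?pos_coord_ge0.
apply/ler_addgt0Pr => e e0; have [N /(_ N (leqnn _)) hN] := hx _ e0.
set S := partial_sum _ _ in hN.
have -> : bcoords (mx_op L M x) i = (bcoords (mx_op L M x) i - S) + S.
  by rewrite subrK.
apply: le_trans (nrmD _ _) _; rewrite [leRHS]addrC; apply: lerD => //.
apply: le_trans (psum_ge N c0 hy); rewrite /S !partial_sumE.
apply: le_trans (nrm_sum _ _ _) _; apply: ler_sum => j _.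
have -> : mx_term M (bcoords x) i j = (M i j)%:C *: bcoords x j by [].
by rewrite nrmZp //; exact: ler_wpM2l.
Qed.

Lemma mx_op_iter_pos M k x : nonneg_mx M -> defines_operator L M -> pos x ->
  pos (iter k (mx_op L M) x).
Proof. by move=> M0 hM px; elim: k => //= k; exact: mx_op_pos. Qed.

Lemma mx_op_iter_mono M k x y : nonneg_mx M -> defines_operator L M ->
  pos x -> pos y -> (forall j, coord x j <= coord y j) ->
  forall i, coord (iter k (mx_op L M) x) i <= coord (iter k (mx_op L M) y) i.
Proof.
move=> M0 hM px py xy; elim: k => //= k IH.
by apply: mx_op_mono => //; exact: mx_op_iter_pos.
Qed.

Lemma mx_op_iter_dom M k x y : nonneg_mx M -> defines_operator L M -> pos y ->
  dom x y -> dom (iter k (mx_op L M) x) (iter k (mx_op L M) y).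
Proof.
move=> M0 hM py xy; elim: k => //= k IH.
by apply: mx_op_dom => //; exact: mx_op_iter_pos.
Qed.

(** On a positive vector the row series of M are dominated by those of c M'; solidity then puts the
    sequence of their sums in L. *)
Lemma dominated_operator M M' (c : R) : nonneg_mx M -> nonneg_mx M' -> 0 <= c ->
  (forall i j, M i j <= c * M' i j) -> defines_operator L M' ->
  defines_operator L M /\ (forall x, pos x -> forall i,
    coord (mx_op L M x) i <= c * coord (mx_op L M' x) i).
Proof.
move=> M0 M'0 c0 MM' hM'.
have key x : pos x -> exists2 y, pos y & pos_image M x y /\
    forall i, coord y i <= c * coord (mx_op L M' x) i.
  move=> px; have [py hy] := mx_op_pos_image M'0 hM' px.
  have /choice[u hu] i : exists s, psum (fun j => M i j * coord x j) s /\
      s <= c * coord (mx_op L M' x) i.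
    have [||s s1 s2] := psum_dominated _ _ (psumZ (a := c) (hy i)) (f :=
      fun j => M i j * coord x j).
    - by move=> j; rewrite mulr_ge0 ?pos_coord_ge0.
    - by move=> j; rewrite mulrA ler_wpM2r ?pos_coord_ge0.
    - by exists s.
  have u0 i : 0 <= u i.
    by apply: psum_ge0 (hu i).1 => j; rewrite mulr_ge0 ?pos_coord_ge0.
  have [|z [pz hz _]] := @solid_pos u (c%:C *: mx_op L M' x).
    by move=> i; rewrite u0 pos_nrm_bcoords ?coordZ; [exact: (hu i).2|exact: posZ].
  by exists z => //; split=> i; rewrite hz; case: (hu i).
have hM : defines_operator L M.
  by apply: defines_operator_pos => // x /key[y py [hy _]]; exists y.
split=> // x px i; have [y py [hy yle]] := key _ px.
by rewrite (mx_op_pos_eq M0 hM px py hy).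
Qed.

Lemma mx_one_ge0 : nonneg_mx (@mx_one R I).
Proof. by move=> i j; rewrite /mx_one ler0n. Qed.

Lemma mx_one_image x : pos_image (@mx_one R I) x x.
Proof.
move=> i; rewrite /mx_one; have := @psum_delta R I (coord x) i.
rewrite (_ : (fun k => _) = (fun j => (i == j)%:R * coord x j)) //.
by apply/funext => j; rewrite mulrC eq_sym.
Qed.

Lemma mx_one_operator : defines_operator L (@mx_one R I).
Proof.
apply: defines_operator_pos mx_one_ge0 _ => x px.
by exists x => //; exact: mx_one_image.
Qed.

Lemma mx_one_op x : pos x -> mx_op L (@mx_one R I) x = x.
Proof.
move=> px; apply: (mx_op_pos_eq mx_one_ge0 mx_one_operator px px).
exact: mx_one_image.
Qed.

Hypothesis hL : normalized L.

Lemma basis_ex b : exists e : L, [/\ pos e, nrm e = 1 &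
  forall j, coord e j = (j == b)%:R].
Proof.
have [e be ne] := hL b; exists e.
have c j : coord e j = (j == b)%:R.
  by rewrite /coord be /unit_seq; case: (j == b).
split=> // [j|]; last by rewrite /nrm ne.
by rewrite be /unit_seq ler0n.
Qed.

(** The vector x_j e_j is dominated by |x|, and e_j has norm 1. *)
Lemma coord_le_nrm x j : `|coord x j| <= nrm x.
Proof.
apply: le_trans (coord_le_nrmb _ _) _.
have [e [pe ne ce]] := basis_ex j.
have <- : nrm (bcoords x j *: e) = nrm (bcoords x j).
  by rewrite nrmZ ne mulr1.
have [p [pp xp px]] := abs_ex x.
apply: le_trans px; apply: dom_nrm => // k.
rewrite bcoordsZ (pos_real _ pe) ce; case: eqP => [->|_] /=.
  by rewrite mulr1.
by rewrite mulr0 nrm0 pos_coord_ge0.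
Qed.

Lemma nrm_bcoords_le x j : nrm (bcoords x j) <= nrm x.
Proof.
have [p [pp xp px]] := abs_ex x.
apply: le_trans (xp j) _; apply: le_trans (ler_norm _) _.
exact: le_trans (coord_le_nrm _ _) px.
Qed.

Lemma basis_image M b (e : L) i : nonneg_mx M -> defines_operator L M -> pos e ->
  (forall j, coord e j = (j == b)%:R) -> coord (mx_op L M e) i = M i b.
Proof.
move=> M0 hM pe ce; have [_ /(_ i) h] := mx_op_pos_image M0 hM pe.
apply: psum_uniq h _.
rewrite (_ : (fun j => _) = (fun j => M i j * (j == b)%:R)).
  exact: psum_delta.
by apply/funext => j; rewrite ce.
Qed.

Lemma entry_le_bound M (b : R) i j : nonneg_mx M -> defines_operator L M ->
  (forall x, pos x -> nrm (mx_op L M x) <= b * nrm x) -> M i j <= b.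
Proof.
move=> M0 hM hb; have [e [pe ne ce]] := basis_ex j.
rewrite -(basis_image i M0 hM pe ce).
apply: le_trans (ler_norm _) _; apply: le_trans (coord_le_nrm _ _) _.
by apply: le_trans (hb _ pe) _; rewrite ne mulr1.
Qed.

(** The series is coordinate i of A (B e_j), whence its convergence; [limn] in [mx_mul] guarantees
    none by itself. *)
Lemma mx_mul_psum A B i j : nonneg_mx A -> nonneg_mx B ->
  defines_operator L A -> defines_operator L B ->
  psum (fun k => A i k * B k j) (mx_mul A B i j).
Proof.
move=> A0 B0 hA hB; have [e [pe ne ce]] := basis_ex j.
have [_ /(_ i) h] := mx_op_pos_image A0 hA (mx_op_pos B0 hB pe).
rewrite /mx_mul.
rewrite (_ : (fun k => A i k * coord (mx_op L B e) k) =
  (fun k => A i k * B k j)) in h.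
  by rewrite (psum_lim h).
by apply/funext => k; rewrite (basis_image k B0 hB pe ce).
Qed.

Lemma mx_mul_ge0 A B : nonneg_mx A -> nonneg_mx B ->
  defines_operator L A -> defines_operator L B -> nonneg_mx (mx_mul A B).
Proof.
move=> A0 B0 hA hB i j; have h := mx_mul_psum A0 B0 hA hB (i := i) (j := j).
apply: psum_ge0 h => k.
by rewrite mulr_ge0.
Qed.

Lemma mx_mul_image A B x : nonneg_mx A -> nonneg_mx B ->
  defines_operator L A -> defines_operator L B -> pos x ->
  pos_image (mx_mul A B) x (mx_op L A (mx_op L B x)).
Proof.
move=> A0 B0 hA hB px i.
have pBx := mx_op_pos B0 hB px.
have [_ /(_ i) hABx] := mx_op_pos_image A0 hA pBx.
have [_ hBx] := mx_op_pos_image B0 hB px.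
have [||h [h1 h2]] :=
  @psum_tonelli R I (fun k j => A i k * (B k j * coord x j)) _ _ _ _ hABx.
- by move=> k j; rewrite !mulr_ge0 ?pos_coord_ge0.
- by move=> k; exact: psumZ (hBx k).
rewrite (_ : (fun j => _) = h) //; apply/funext => j.
apply: psum_uniq (h1 j); rewrite /= mulrC.
rewrite (_ : (fun k => _) = (fun k => coord x j * (A i k * B k j))).
  by apply: psumZ; exact: mx_mul_psum.
by apply/funext => k; ring.
Qed.

Lemma mx_mul_operator A B : nonneg_mx A -> nonneg_mx B ->
  defines_operator L A -> defines_operator L B ->
  defines_operator L (mx_mul A B).
Proof.
move=> A0 B0 hA hB; apply: defines_operator_pos; first exact: mx_mul_ge0.
move=> x px; exists (mx_op L A (mx_op L B x)); last exact: mx_mul_image.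
by do 2!apply: mx_op_pos => //.
Qed.

Lemma mx_mul_op A B x : nonneg_mx A -> nonneg_mx B ->
  defines_operator L A -> defines_operator L B -> pos x ->
  mx_op L (mx_mul A B) x = mx_op L A (mx_op L B x).
Proof.
move=> A0 B0 hA hB px; apply: mx_op_pos_eq => //.
- exact: mx_mul_ge0.
- exact: mx_mul_operator.
- by do 2!apply: mx_op_pos => //.
- exact: mx_mul_image.
Qed.

(** Coordinates are bounded by the norm, so being real and nonnegative passes to norm limits. *)
Lemma pos_closed x :
  (forall e : R, 0 < e -> exists2 p, pos p & nrm (x - p) <= e) -> pos x.
Proof.
move=> h; apply/posP => j.
have Im_eq (c d : R[i]) : complex.Im (c - d) = complex.Im c - complex.Im d.
  by case: c d => ? ? [].
split.
  rewrite /coord; have : complex.Im (bcoords x j) = 0.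
    apply/eqP; rewrite -normr_eq0 eq_le normr_ge0 andbT.
    apply/ler_addgt0Pr => e e0; rewrite add0r.
    have [p pp xp] := h _ e0; apply: le_trans xp.
    apply: le_trans (nrm_bcoords_le _ j); apply: le_trans (imag_part_le _).
    by rewrite bcoordsB Im_eq (pos_real _ pp) /= subr0.
  by case: (bcoords x j) => a b /= ->.
apply/ler_addgt0Pr => e e0; have [p pp xp] := h _ e0.
have := le_trans (coord_le_nrm (x - p) j) xp; rewrite coordB distrC => h1.
have := le_trans (ler_norm _) h1; have := pos_coord_ge0 j pp; lra.
Qed.

(* Were a positive operator unbounded, some x_n >= 0 of norm 2^-n would have
   images of norm > n, and the sum of the x_n would have no image. *)
Lemma mx_op_bounded M : nonneg_mx M -> defines_operator L M ->
  bounded_linear (mx_op L M).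
Proof.
move=> M0 hM; split; first exact: mx_op_linear.
apply: contrapT => unb.
have key n : exists x, [/\ pos x, nrm x <= 2^-1 ^+ n.+1 & n%:R < nrm (mx_op L M x)].
  have : exists x, n%:R * 2 ^+ n.+1 * nrm x < nrm (mx_op L M x).
    apply: contrapT => /forallNP h; apply: unb; exists (n%:R * 2 ^+ n.+1).
      by rewrite mulr_ge0 ?exprn_ge0.
    by move=> x; rewrite leNgt; apply/negP; exact: h.
  move=> [x hx]; have [p [pp xp px]] := abs_ex x.
  have Tp : nrm (mx_op L M x) <= nrm (mx_op L M p).
    by apply: dom_nrm; [exact: mx_op_pos|exact: mx_op_dom].
  have x0 : 0 < nrm x.
    rewrite lt_neqAle nrm_ge0 andbT eq_sym; apply/eqP => /nrm_eq0 x0.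
    by move: hx; rewrite x0 (linear_zero (mx_op_linear hM)) nrm0 mulr0 ltxx.
  (* This scaling brings the norm down to 2^-(n+1) and turns the threshold n 2^(n+1) |x| into n. *)
  pose a := 2^-1 ^+ n.+1 / nrm x.
  have a0 : 0 < a by rewrite divr_gt0 // exprn_gt0.
  exists (a%:C *: p); split.
  - by apply: posZ => //; exact: ltW.
  - rewrite nrmZp; last exact: ltW.
    rewrite /a -mulrA; apply: ler_piMr; first by rewrite exprn_ge0.
    by rewrite mulrC ler_pdivrMr // mul1r.
  - rewrite (linear_scale _ _ (mx_op_linear hM)) nrmZp; last exact: ltW.
    apply: lt_le_trans (_ : a * nrm (mx_op L M x) <= _); last by rewrite ler_pM2l.
    rewrite mulrC -ltr_pdivrMr // (_ : n%:R / a = n%:R * 2 ^+ n.+1 * nrm x) //.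
    by rewrite /a invfM invrK exprVn invrK mulrA.
have /choice[u hu] := key.
have c1 : `|2^-1 : R| < 1 by rewrite ger0_norm // invf_lt1 // ltr1n.
have [||W hW] := @summable_sum R L u (geometric 2^-1 2^-1).
- by move=> n; have [_ h _] := hu n; rewrite /= -exprS.
- exact: is_cvg_geometric_series.
(* W - u_n is the limit of the partial sums with the positive term u_n removed, so W dominates every
   u_n. *)
have Wge n : pos (W - u n).
  apply: pos_closed => e e0.
  have /cvgrPdist_le /(_ e e0)[N _ hN] := is_cvg_geometric_series (a := 2^-1) c1.
  exists (\sum_(j < (n + N).+1) u j - u n).
    rewrite (bigD1 (inord n)) //= inordK ?ltnS ?leq_addr // addrC addrK.
    by elim/big_ind: _ => // [|x y|j _]; [exact: pos0|exact: posD|case: (hu j)].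
  rewrite opprB addrA subrK; apply: le_trans (hW _) _.
  apply: le_trans (ler_norm _) _; apply: hN => /=.
  by rewrite leqW // leq_addl.
have pW : pos W.
  by have := posD (Wge 0%N) (let: And3 p _ _ := hu 0%N in p); rewrite subrK.
have [n hn] : exists n : nat, nrm (mx_op L M W) <= n%:R.
  by exists (Num.bound (nrm (mx_op L M W))); exact: ltW (archi_boundP (nrm_ge0 _)).
have [pn _ ln] := hu n.
suff : nrm (mx_op L M (u n)) <= nrm (mx_op L M W).
  by move=> h; have := lt_le_trans ln (le_trans h hn); rewrite ltxx.
apply: dom_nrm; first exact: mx_op_pos.
apply: mx_op_dom => // j; rewrite pos_nrm_bcoords // -subr_ge0 -coordB.
exact: pos_coord_ge0 j (Wge n).
Qed.

End SequenceSpace.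

(** * Positive resolvents and the exponential *)

Section PositiveResolvent.
Variables (R : realType) (I : index_set) (L : banachSeqSpace R I).
Hypothesis hL : normalized L.
Implicit Types (x y z : L) (Q S B T : L -> L).

Definition positive_op T := forall x, pos x -> pos (T x).

Definition is_resolvent Q (t : R) S := [/\ bounded_linear S,
  forall x, S (t%:C *: x - Q x) = x & forall x, t%:C *: S x - Q (S x) = x].

(** The iterates of q -> p + c B q from 0 are positive and converge to y with ratio c b. *)
Lemma pos_fixpoint B (b c : R) p y : bounded_linear B -> positive_op B ->
  (forall x, nrm (B x) <= b * nrm x) -> 0 <= b -> 0 <= c -> c * b < 1 ->
  pos p -> y = p + c%:C *: B y -> pos y.
Proof.
move=> [lB _] pB hb b0 c0 cb pp yE.
have approx N : exists2 q, pos q & nrm (y - q) <= (c * b) ^+ N * nrm y.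
  elim: N => [|N [q pq hq]].
    by exists 0; [exact: pos0|rewrite subr0 expr0 mul1r].
  exists (p + c%:C *: B q); first by apply: posD => //; apply: posZ => //;
    exact: pB.
  rewrite {1}yE opprD addrACA subrr add0r -scalerBr -(linear_sub _ _ lB).
  rewrite nrmZp // exprS -!mulrA; apply: ler_wpM2l => //.
  by apply: le_trans (hb _) _; apply: ler_wpM2l.
apply: (pos_closed hL) => e e0.
have cb1 : `|c * b| < 1 by rewrite ger0_norm // mulr_ge0.
have /cvgrPdist_le /(_ e e0)[N _ /(_ N (leqnn N)) hN] :=
  @cvg_geometric R (nrm y) _ cb1.
have [q pq hq] := approx N; exists q => //; apply: le_trans hq _.
rewrite mulrC; apply: le_trans (ler_norm _) _.
by move: hN; rewrite /= sub0r normrN.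
Qed.

(** The resolvent identity, arranged as a fixed-point equation for S x as [pos_fixpoint] expects
    it. *)
Lemma resolvent_shift Q (s t : R) S S' x : is_resolvent Q s S ->
  is_resolvent Q t S' -> S x = S' x + (t - s)%:C *: S' (S x).
Proof.
move=> [_ _ hS] [[lS' _] hS' _].
rewrite -[LHS]hS' -(linear_scale _ _ lS') -(linear_add _ _ lS'); congr (S' _).
rewrite rmorphB /= scalerBl -[X in _ = X + _](hS x).
by rewrite [RHS]addrC subrKA.
Qed.

Lemma resolvent_pos Q (t0 : R) S0 : bounded_linear Q -> positive_op Q ->
  (forall s, t0 <= s -> exists S, is_resolvent Q s S) ->
  is_resolvent Q t0 S0 -> positive_op S0.
Proof.
move=> bQ pQ hres hS0; have [lQ [b b0 hb]] := bQ.
pose G := [set s | t0 <= s /\ forall S, is_resolvent Q s S -> positive_op S].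
(* For s > b the equation S x = x/s + Q (S x)/s is itself a contraction. *)
have Gbig : G (Num.max t0 (b + 1)).
  set s := Num.max _ _; have sb : b + 1 <= s by rewrite le_max lexx orbT.
  have s0 : 0 < s by apply: lt_le_trans sb; rewrite ltr_wpDl.
  split=> [|S [bS _ hS] x px]; first by rewrite le_max lexx.
  apply: (@pos_fixpoint Q b s^-1 (s^-1%:C *: x) (S x)) => //.
  - by rewrite invr_ge0 ltW.
  - by rewrite mulrC ltr_pdivrMr // mul1r; apply: lt_le_trans sb; rewrite ltrDl.
  - by apply: posZ => //; rewrite invr_ge0 ltW.
  - rewrite -[in X in _ = X + _](hS x) -scalerDr subrK scalerA -rmorphM.
    by rewrite mulVf ?gt_eqF // scale1r.
have infG : has_inf G by split; [eexists; exact: Gbig|exists t0 => s []].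
set sg := inf G.
have sg_ge : t0 <= sg by apply: lb_le_inf; [exact: infG.1|move=> s []].
have [Sg hSg] := hres _ sg_ge.
have [[lSg [K K0 hK]] _ _] := hSg.
(* K bounds the resolvent at the infimum [sg]. As d K <= 1/4, the resolvent at [s1], less than d
   above [sg], is bounded by 2 K; and (2 d)(2 K) < 1 permits a step of 2 d down from [s1], past
   [sg]. *)
pose d := (4%:R * (K + 1))^-1.
have K1 : 0 < K + 1 by rewrite ltr_wpDl.
have d0 : 0 < d by rewrite invr_gt0 mulr_gt0.
have dK : d * K <= 4%:R^-1.
  rewrite /d invfM -mulrA ler_piMr // mulrC ler_pdivrMr // mul1r lerDl;
    exact: ler01.
have [s1 [s1t s1G] s1lt] := inf_adherent d0 infG.
have [S1 hS1] := hres _ s1t.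
have [[lS1 _] _ _] := hS1.
have s1sg : sg <= s1 by apply: ge_inf; [exact: infG.2|].
have hS1b x : nrm (S1 x) <= (2%:R * K) * nrm x.
  have h : nrm (S1 x) <= K * nrm x + 4%:R^-1 * nrm (S1 x).
    rewrite {1}(resolvent_shift x hS1 hSg); apply: le_trans (nrmD _ _) _.
    apply: lerD => //; rewrite nrmZr.
    apply: (@le_trans _ _ (d * (K * nrm (S1 x)))).
      apply: ler_pM; rewrite ?nrm_ge0 //.
      rewrite distrC ger0_norm ?subr_ge0 // lerBlDl ltW //.
    by rewrite mulrA; apply: ler_wpM2r => //; exact: nrm_ge0.
  have := nrm_ge0 x; have := nrm_ge0 (S1 x); rewrite -mulrA; lra.
have sG : G (Num.max t0 (s1 - 2%:R * d)).
  set s := Num.max _ _.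
  have ss1 : s <= s1.
    by rewrite ge_max s1t /= gerBl mulr_ge0 // ltW.
  have s2 : s1 - 2%:R * d <= s by rewrite le_max lexx orbT.
  split=> [|S hS x px]; first by rewrite le_max lexx.
  apply: (@pos_fixpoint S1 (2%:R * K) (s1 - s) (S1 x) (S x)) => //.
  - by case: hS1.
  - exact: s1G hS1.
  - by rewrite mulr_ge0.
  - by rewrite subr_ge0.
  - apply: (@le_lt_trans _ _ ((2%:R * d) * (2%:R * K))).
      by apply: ler_wpM2r; [rewrite mulr_ge0|lra].
    have dE : d * K + d = 4%:R^-1.
      by rewrite -[X in _ + X]mulr1 -mulrDr /d invfM -mulrA mulVf ?mulr1 ?gt_eqF.
    by rewrite mulrACA; lra.
  - exact: s1G hS1 _ px.
  - exact: resolvent_shift hS hS1.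
(* Since s1 - 2 d < sg, only sg <= t0 is possible; the maximum is then t0, which therefore lies in
   G. *)
have := ge_inf infG.2 sG; rewrite -/sg le_max => /orP[h|h].
  have : Num.max t0 (s1 - 2%:R * d) = t0.
    apply/eqP; rewrite eq_le le_max lexx andbT ge_max lexx /=.
    have : s1 - 2%:R * d < sg by rewrite ltrBlDr; lra.
    by move=> /ltW/le_trans; apply.
  by move=> h2; move: sG.2; rewrite h2; apply.
exfalso; move: h; lra.
Qed.

End PositiveResolvent.

(** * Growth of a positive operator from the resolvents of its exponential *)

Section PositiveExponential.
Variables (R : realType) (I : index_set) (L : banachSeqSpace R I).
Hypothesis hL : normalized L.
Variable A : imatrix R I.
Hypotheses (A0 : nonneg_mx A) (hA : defines_operator L A).
Implicit Types (x y z : L).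

Let T : L -> L := mx_op L A.
Let Q : L -> L := op_exp T.

Let lT : linear T. Proof. exact: mx_op_linear. Qed.
Let bT : bounded_linear T. Proof. exact: (mx_op_bounded hL). Qed.
Let bQ : bounded_linear Q. Proof. exact: op_exp_bounded_linear. Qed.

Lemma op_exp_ge_partial k x : pos x -> pos (Q x - exp_partial T k x).
Proof.
move=> px; apply: (pos_closed hL) => e e0.
have K0 : 0 < nrm x + 1 by rewrite ltr_wpDl // nrm_ge0.
have [N hN] := op_exp_lim bT (divr_gt0 e0 K0).
exists (exp_partial T (k + N) x - exp_partial T k x).
  elim: N {hN} => [|N IH]; first by rewrite addn0 subrr; exact: pos0.
  rewrite addnS /exp_partial big_ord_recr /= addrAC; apply: posD => //.
  by apply: posZ; [rewrite invr_ge0|exact: mx_op_iter_pos].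
rewrite opprB addrA subrK nrm_distC.
apply: le_trans (hN _ (leq_addl _ _) _) _.
by rewrite mulrAC ler_pdivrMr // ler_wpM2l ?ltW // ltrDl.
Qed.

Lemma op_exp_pos : positive_op Q.
Proof.
move=> x px; have := op_exp_ge_partial 0 px.
by rewrite /exp_partial big_ord0 subr0.
Qed.

Lemma op_exp_resolvent (t : R) : spectral_radius Q < t ->
  exists2 S, is_resolvent Q t S & positive_op S.
Proof.
move=> rt; have hres s : t <= s -> exists S, is_resolvent Q s S.
  move=> ts; exact: resolvent_ex bQ (lt_le_trans rt ts).
have [S hS] := hres _ (lexx t); exists S => //.
exact: (resolvent_pos hL bQ op_exp_pos hres hS).
Qed.

(** For y = S e_b, t y_b = 1 + (Q y)_b >= 1 + y_b with y_b >= 0, so t <= 1 is impossible. It ensures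
    ln t > 0, as the rates in [power_growth] must be positive. *)
Lemma spectral_radius_exp_ge1 (t : R) : spectral_radius Q < t -> 1 < t.
Proof.
move=> /op_exp_resolvent[S [_ _ hS] pS].
have b : idx I by case: (I) => [n|]; [exact: ord0|exact: 0%N].
have [e [pe _ ce]] := basis_ex hL b.
have py := pos_coord_ge0 b (pS _ pe).
have := op_exp_ge_partial 1 (pS _ pe).
rewrite /exp_partial big_ord1 /= fact0 invr1 scale1r => /(pos_coord_ge0 b).
have := congr1 (fun v : L => coord v b) (hS e);
  rewrite /= !coordB coordZ ce eqxx /= mulr1n.
move: (coord (S e) b) (coord (Q (S e)) b) py => u v u0 h1 h2.
rewrite ltNge; apply/negP => t1.
have : t * u <= u by rewrite ler_piMl.
by move: h1 h2; lra.
Qed.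

(* The sum of the s^a T^b over a + b = i - 1. *)
Fixpoint divided_power (s : R) i x : L :=
  if i is i'.+1 then s%:C *: divided_power s i' x + iter i' T x else 0.

Lemma divided_power_bounded s i : bounded_linear (divided_power s i).
Proof.
elim: i => [|i IH] /=; first exact: bounded_linear_zero.
apply: bounded_linear_add (bounded_linear_iter _ bT).
exact: bounded_linear_scale.
Qed.

Lemma divided_power_pos s i x : 0 <= s -> pos x -> pos (divided_power s i x).
Proof.
move=> s0 px; elim: i => [|i IH] /=; first exact: pos0.
by apply: posD; [exact: posZ|exact: mx_op_iter_pos].
Qed.

Lemma divided_powerE s i x :
  s%:C *: divided_power s i x - T (divided_power s i x)
    = (s ^+ i)%:C *: x - iter i T x.
Proof.
elim: i => [|i IH] /=;
  first by rewrite scaler0 (linear_zero lT) expr0 scale1r !subrr.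
rewrite (linear_add _ _ lT) (linear_scale _ _ lT) scalerDr opprD addrACA.
rewrite -scalerBr IH scalerBr scalerA -rmorphM exprS.
by rewrite addrA subrK.
Qed.

(* With y = (t - exp T)^-1 x, the operator Z below is the truncated divided
   difference (e^s - e^T)/(s - T), and Z y is the z of the introduction. *)
Lemma power_growth (s t : R) : 0 < s -> t < expR s -> spectral_radius Q < t ->
  exists2 C, 0 <= C & forall n x, pos x -> nrm (iter n T x) <= C * s ^+ n * nrm x.
Proof.
move=> s0 ts /op_exp_resolvent[S [[_ [c c0 hc]] _ hS] pS].
have [N hN] : exists N, t <= \sum_(i < N) i`!%:R^-1 * s ^+ i.
  have d0 : 0 < expR s - t by rewrite subr_gt0.
  have /cvgrPdist_le /(_ _ d0)[N _ /(_ N (leqnn N)) hN] :=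
    is_cvg_series_exp_coeff s.
  exists N; have := le_trans (ler_norm _) hN.
  rewrite -/(expR s) lerBlDr addrC -lerBlDr opprB addrC subrK.
  by rewrite exp_coeffE seriesEord.
pose F i x := (i`!%:R^-1)%:C *: divided_power s i x.
pose Z x := \sum_(i < N) F i x.
have [lZ [d d0 hd]] : bounded_linear Z.
  apply: bounded_linear_sum => i; apply: bounded_linear_scale.
  exact: divided_power_bounded.
(* c bounds the resolvent and d bounds Z, so |z| <= d c |x|; the factor s comes from x <= s z. *)
exists (s * (d * c)) => [|n x px]; first by rewrite !mulr_ge0 // ltW.
have py := pS _ px; set y := S x in py.
have pz : pos (Z y).
  apply: (@pos_sum _ _ _ N (fun i => F i y)) => i; apply: posZ;
    first by rewrite invr_ge0.
  by apply: divided_power_pos => //; exact: ltW.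
have zE : s%:C *: Z y - T (Z y) =
    (\sum_(i < N) i`!%:R^-1 * s ^+ i)%:C *: y - exp_partial T N y.
  rewrite /Z (linear_bigsum _ _ lT) scaler_sumr -sumrB rmorph_sum scaler_suml.
  rewrite /exp_partial -sumrB; apply: eq_bigr => i _.
  rewrite /F (linear_scale _ _ lT) scalerA mulrC -scalerA -scalerBr.
  by rewrite divided_powerE scalerBr scalerA -rmorphM.
(* With e_N the truncated exponential: (s - T) z = e_N(s) y - e_N(T) y >= t y - exp(T) y = x. *)
have sup j : coord x j + coord (T (Z y)) j <= s * coord (Z y) j.
  have := pos_coord_ge0 j (op_exp_ge_partial N py).
  have := congr1 (fun v : L => coord v j) (hS x); rewrite /= -/y.
  have := congr1 (fun v : L => coord v j) zE; rewrite /= !coordB !coordZ.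
  have := ler_wpM2r (pos_coord_ge0 j py) hN.
  lra.
have itz k j : coord (iter k T (Z y)) j <= s ^+ k * coord (Z y) j.
  elim: k j => [|k IH] j; first by rewrite mul1r.
  have -> : iter k.+1 T (Z y) = iter k T (T (Z y)) by rewrite iterSr.
  apply: (@le_trans _ _ (coord (iter k T (s%:C *: Z y)) j)).
    apply: mx_op_iter_mono => //; first exact: mx_op_pos.
      by apply: posZ => //; exact: ltW.
    move=> i; rewrite coordZ; apply: le_trans (sup i); rewrite lerDr.
    exact: pos_coord_ge0.
  rewrite (linear_scale _ _ (linear_iter k lT)) coordZ exprS -mulrA.
  by apply: ler_wpM2l; [exact: ltW|exact: IH].
have pzn : pos ((s ^+ n.+1)%:C *: Z y) by apply: posZ => //;
  rewrite exprn_ge0 // ltW.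
apply: (@le_trans _ _ (nrm ((s ^+ n.+1)%:C *: Z y))).
  apply: dom_nrm => // j.
  rewrite pos_nrm_bcoords; last exact: mx_op_iter_pos.
  apply: (@le_trans _ _ (coord (iter n T (s%:C *: Z y)) j)).
    apply: mx_op_iter_mono => //; first by apply: posZ => //; exact: ltW.
    move=> i; rewrite coordZ; apply: le_trans (sup i); rewrite lerDl.
    by apply: pos_coord_ge0; exact: mx_op_pos.
  rewrite (linear_scale _ _ (linear_iter n lT)) !coordZ exprS -mulrA.
  by apply: ler_wpM2l; [exact: ltW|exact: itz].
rewrite nrmZp; last by rewrite exprn_ge0 // ltW.
have -> : s * (d * c) * s ^+ n * nrm x = s ^+ n.+1 * (d * (c * nrm x)).
  by rewrite exprS; ring.
apply: ler_wpM2l; first by rewrite exprn_ge0 // ltW.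
by apply: le_trans (hd _) _; apply: ler_wpM2l => //; exact: hc.
Qed.

End PositiveExponential.

(** * Hadamard products *)

Section ExponentialGrowth.
Variables (R : realType) (E : completeNormedModType R[i]).
Implicit Types (T : E -> E) (x : E).

Lemma exp_partial_le_expR (s : R) k : 0 <= s ->
  \sum_(i < k) i`!%:R^-1 * s ^+ i <= expR s.
Proof.
move=> s0.
have -> : \sum_(i < k) i`!%:R^-1 * s ^+ i = series (exp_coeff s) k.
  by rewrite exp_coeffE seriesEord.
apply: nondecreasing_cvgn_le (is_cvg_series_exp_coeff s) k.
by apply: nondecreasing_series => n _ _; exact: exp_coeff_ge0.
Qed.

(** T^j exp(T) x is the sum of the T^(i+j) x / i!. Hypothesis and conclusion bound an orbit in the
    same form, so the step can be repeated for each further factor exp(T). *)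
Lemma op_exp_orbit T (s K : R) x : bounded_linear T -> 0 <= s -> 0 <= K ->
  (forall j, nrm (iter j T x) <= K * s ^+ j) ->
  forall j, nrm (iter j T (op_exp T x)) <= K * expR s * s ^+ j.
Proof.
move=> bT s0 K0 hx j; have [lT [b b0 hb]] := bT.
apply/ler_addgt0Pr => e e0.
have M0 : 0 < b ^+ j * nrm x + 1.
  by rewrite ltr_wpDl // mulr_ge0 ?exprn_ge0 ?nrm_ge0.
have [N /(_ N (leqnn _) x) hN] := op_exp_lim bT (divr_gt0 e0 M0).
have -> : iter j T (op_exp T x) = iter j T (exp_partial T N x)
    - iter j T (exp_partial T N x - op_exp T x).
  by rewrite (linear_sub _ _ (linear_iter j lT)) opprB addrC subrK.
apply: le_trans (nrmB _ _) _; apply: lerD.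
  rewrite /exp_partial (linear_bigsum _ _ (linear_iter j lT)).
  apply: le_trans (nrm_sum _ _ _) _.
  apply: (@le_trans _ _ (K * s ^+ j * \sum_(i < N) i`!%:R^-1 * s ^+ i)).
    rewrite big_distrr; apply: ler_sum => i _ /=.
    rewrite (linear_scale _ _ (linear_iter j lT)) nrmZp ?invr_ge0 // -iterD.
    rewrite mulrCA; apply: ler_wpM2l; first by rewrite invr_ge0.
    by rewrite -mulrA -exprD; exact: hx.
  rewrite mulrAC; apply: ler_wpM2r; first exact: exprn_ge0.
  apply: ler_wpM2l => //; exact: exp_partial_le_expR.
apply: le_trans (iter_norm_bound _ _ b0 hb) _.
apply: (@le_trans _ _ (b ^+ j * (e / (b ^+ j * nrm x + 1) * nrm x))).
  by apply: ler_wpM2l => //; exact: exprn_ge0.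
set M := b ^+ j * nrm x + 1 in M0 hN *.
have -> : b ^+ j * (e / M * nrm x) = e * ((b ^+ j * nrm x) / M) by ring.
by rewrite ler_piMr ?(ltW e0) // ler_pdivrMr // mul1r lerDl.
Qed.

Lemma op_exp_growth T (s c : R) : bounded_linear T -> 0 <= s -> 0 <= c ->
  (forall j x, nrm (iter j T x) <= c * s ^+ j * nrm x) ->
  forall k x, nrm (iter k (op_exp T) x) <= c * expR s ^+ k * nrm x.
Proof.
move=> bT s0 c0 hT k x.
suff /(_ 0%N) : forall j, nrm (iter j T (iter k (op_exp T) x))
    <= c * expR s ^+ k * nrm x * s ^+ j by rewrite expr0 mulr1.
elim: k => [|k IH] j /=.
  by rewrite expr0 mulr1 mulrAC; exact: hT.
have K0 : 0 <= c * expR s ^+ k * nrm x.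
  by rewrite !mulr_ge0 ?exprn_ge0 ?nrm_ge0 ?expR_ge0.
apply: le_trans (op_exp_orbit bT s0 K0 IH j) _.
by rewrite exprSr !mulrA (mulrAC _ _ (expR s)) lexx.
Qed.

End ExponentialGrowth.

(** * Powers of the Hadamard product against cyclic products *)

Section CyclicProducts.
Variables (R : realType) (I : index_set) (L : banachSeqSpace R I).
Hypothesis hL : normalized L.
Variables (m : nat) (A : 'I_m.+1 -> imatrix R I).
Hypothesis A_ge0 : forall k, nonneg_mx (A k).
Hypothesis A_op : forall k, defines_operator L (A k).
Implicit Types (x : L).

Let B (k : nat) : imatrix R I := A (inord (k %% m.+1)).

(* The product of N consecutive factors of the periodic sequence A_0, ..., A_m,
   A_0, ..., starting at the factor of index i. *)
Definition cyclic_prod i N : imatrix R I :=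
  \big[@mx_mul R I/@mx_one R I]_(k <- iota i N) B k.

Lemma cyclic_prod0 i : cyclic_prod i 0 = @mx_one R I.
Proof. by rewrite /cyclic_prod big_nil. Qed.

Lemma cyclic_prodS i N : cyclic_prod i N.+1 = mx_mul (B i) (cyclic_prod i.+1 N).
Proof. by rewrite /cyclic_prod big_cons. Qed.

Lemma cyclic_prod_period n i N : cyclic_prod (n * m.+1 + i) N = cyclic_prod i N.
Proof.
elim: N i => [|N IH] i; first by rewrite !cyclic_prod0.
by rewrite !cyclic_prodS -addnS IH /B modnMDl.
Qed.

Lemma cyclic_prod_full : cyclic_prod 0 m.+1 = mx_prod A.
Proof.
rewrite /cyclic_prod /mx_prod -[iota _ _]/(index_iota 0 m.+1) big_mkord.
by apply: eq_bigr => k _; rewrite /B modn_small // inord_val.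
Qed.

Lemma cyclic_prod_operator i N :
  nonneg_mx (cyclic_prod i N) /\ defines_operator L (cyclic_prod i N).
Proof.
elim: N i => [|N IH] i.
  by rewrite cyclic_prod0; split; [exact: mx_one_ge0|exact: mx_one_operator].
have [W0 hW] := IH i.+1; rewrite cyclic_prodS; split.
- exact: (mx_mul_ge0 hL (A_ge0 _) W0 (A_op _) hW).
- exact: (mx_mul_operator hL (A_ge0 _) W0 (A_op _) hW).
Qed.

Let W_ge0 i N : nonneg_mx (cyclic_prod i N).
Proof. by case: (cyclic_prod_operator i N). Qed.

Let W_op i N : defines_operator L (cyclic_prod i N).
Proof. by case: (cyclic_prod_operator i N). Qed.

Lemma cyclic_prod_opS i N x : pos x ->
  mx_op L (cyclic_prod i N.+1) x = mx_op L (B i) (mx_op L (cyclic_prod i.+1 N) x).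
Proof.
move=> px; rewrite cyclic_prodS.
exact: (mx_mul_op hL (A_ge0 _) (W_ge0 _ _) (A_op _) (W_op _ _) px).
Qed.

(** Stated on vectors, where it is associativity of composition; on matrices it would require
    associativity of [mx_mul]. *)
Lemma cyclic_prod_cat i N N' x : pos x ->
  mx_op L (cyclic_prod i (N + N')) x =
  mx_op L (cyclic_prod i N) (mx_op L (cyclic_prod (i + N) N') x).
Proof.
move=> px; elim: N i => [|N IH] i.
  rewrite cyclic_prod0 mx_one_op ?addn0 //.
  exact: mx_op_pos.
have py : pos (mx_op L (cyclic_prod (i + N.+1) N') x) by exact: mx_op_pos.
rewrite addSn (cyclic_prod_opS i (N + N') px) (cyclic_prod_opS i N py).
by rewrite (IH i.+1) [(i.+1 + N)%N]addSnnS.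
Qed.

Lemma cyclic_prod_pow n x : pos x ->
  mx_op L (cyclic_prod 0 (n * m.+1)) x = iter n (mx_op L (mx_prod A)) x.
Proof.
move=> px; elim: n => [|n IH]; first by rewrite mul0n cyclic_prod0 mx_one_op.
rewrite mulSn cyclic_prod_cat // -[(0 + m.+1)%N]addn0 add0n -{2}(mul1n m.+1).
by rewrite cyclic_prod_period IH cyclic_prod_full.
Qed.

(** Starting at i, m + 1 - i factors complete the period, n full periods follow, and i factors
    remain. The two outer pieces do not depend on n. *)
Lemma cyclic_prod_rotate (i : 'I_m.+1) n x : pos x ->
  mx_op L (cyclic_prod i (n.+1 * m.+1)) x =
  mx_op L (cyclic_prod i (m.+1 - i))
    (iter n (mx_op L (mx_prod A)) (mx_op L (cyclic_prod 0 i) x)).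
Proof.
move=> px; have im : (i <= m.+1)%N by exact: ltnW.
have -> : (n.+1 * m.+1 = (m.+1 - i) + (n * m.+1 + i))%N.
  by rewrite addnCA subnK // mulSn addnC.
rewrite cyclic_prod_cat // subnKC // cyclic_prod_cat //.
have -> N : cyclic_prod m.+1 N = cyclic_prod 0 N.
  by rewrite -[X in cyclic_prod X]addn0 -{1}(mul1n m.+1) cyclic_prod_period.
rewrite (_ : (m.+1 + n * m.+1)%N = (n.+1 * m.+1 + 0)%N) ?cyclic_prod_period.
  by rewrite cyclic_prod_pow //; exact: mx_op_pos.
by rewrite mulSn addn0.
Qed.

Lemma hadamard_ge0 : nonneg_mx (hadamard_prod A).
Proof. by move=> a b; apply: prodr_ge0 => k _; exact: A_ge0. Qed.

Lemma operator_entries_bounded M : nonneg_mx M -> defines_operator L M ->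
  exists2 c : R, 0 <= c & forall a b, M a b <= c.
Proof.
move=> M0 hM; have [_ [c c0 hc]] := mx_op_bounded hL M0 hM.
by exists c => // a b; apply: (entry_le_bound hL) => // x _; exact: hc.
Qed.

(** All factors but the first have bounded entries, so the Hadamard product is at most a multiple of
    [A ord0]. *)
Lemma hadamard_operator : defines_operator L (hadamard_prod A).
Proof.
have /choice[c hc] k : exists c : R, 0 <= c /\ forall a b, A k a b <= c.
  by have [c c0 hc] := operator_entries_bounded (A_ge0 k) (@A_op k); exists c.
have c0 : 0 <= \prod_(k < m) c (lift ord0 k).
  by apply: prodr_ge0 => k _; case: (hc (lift ord0 k)).
have [|//] := @dominated_operator _ _ L (hadamard_prod A) (A ord0) _
  hadamard_ge0 (A_ge0 _) c0 _ (@A_op ord0).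
move=> a b; rewrite /hadamard_prod big_ord_recl mulrC; apply: ler_wpM2r.
  exact: A_ge0.
by apply: ler_prod => k _; rewrite A_ge0 (hc (lift ord0 k)).2.
Qed.

Let H_ge0 := hadamard_ge0.
Let H_op := hadamard_operator.

Definition hadamard_pow N : imatrix R I :=
  iter N (mx_mul (hadamard_prod A)) (@mx_one R I).

Lemma hadamard_pow_operator N :
  nonneg_mx (hadamard_pow N) /\ defines_operator L (hadamard_pow N).
Proof.
elim: N => [|N [IH1 IH2]]; first by split;
  [exact: mx_one_ge0|exact: mx_one_operator].
by split; [exact: mx_mul_ge0|exact: mx_mul_operator].
Qed.

Lemma hadamard_pow_op N x : pos x ->
  mx_op L (hadamard_pow N) x = iter N (mx_op L (hadamard_prod A)) x.
Proof.
move=> px; elim: N => [|N IH]; first exact: mx_one_op.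
have [h1 h2] := hadamard_pow_operator N.
by rewrite [hadamard_pow _]/= (mx_mul_op hL) // IH.
Qed.

(* The product over i is invariant under i -> i + 1, which makes the
   induction step a rowwise application of sum prod <= prod sum. *)
Lemma hadamard_pow_le N a b :
  hadamard_pow N a b <= \prod_(i < m.+1) cyclic_prod i N a b.
Proof.
elim: N a b => [|N IH] a b.
  (* Entries of the identity are 0 or 1, hence equal to their power of positive exponent m + 1. *)
  under eq_bigr do rewrite cyclic_prod0.
  rewrite prodr_const card_ord /hadamard_pow /= /mx_one.
  by case: (a == b); rewrite ?expr1n // expr0n.
have [h1 h2] := hadamard_pow_operator N.
apply: psum_le_of (mx_mul_psum (i := a) (j := b) hL H_ge0 h1 H_op h2) _ => k.
have rot l : \prod_(i < m.+1) cyclic_prod i N l b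
    = \prod_(i < m.+1) cyclic_prod i.+1 N l b.
  rewrite big_ord_recl big_ord_recr mulrC /=; congr (_ * _).
  by rewrite -[X in _ =
    cyclic_prod X _ _ _]addn0 -{1}(mul1n m.+1) cyclic_prod_period.
apply: (@le_trans _ _ (partial_sum
    (fun l => \prod_(i < m.+1) (B i a l * cyclic_prod i.+1 N l b)) k)).
  apply: partial_sum_le => l; rewrite big_split /= -rot.
  apply: ler_pM => //; rewrite /hadamard_prod.
  have -> // : \prod_i A i a l = \prod_(i < m.+1) B i a l.
  by apply: eq_bigr => i _; rewrite /B modn_small // inord_val.
apply: psum_prod => [i l|i]; first by apply: mulr_ge0; [exact: A_ge0|exact: W_ge0].
rewrite cyclic_prodS.
exact: (mx_mul_psum hL (A_ge0 _) (W_ge0 _ _) (A_op _) (W_op _ _)).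
Qed.

Lemma hadamard_growth (s C : R) : 0 < s -> 0 <= C ->
  (forall n x, pos x ->
    nrm (iter n (mx_op L (mx_prod A)) x) <= C * s ^+ n * nrm x) ->
  exists2 c, 0 <= c &
    forall j x, nrm (iter j (mx_op L (hadamard_prod A)) x) <= c * s ^+ j * nrm x.
Proof.
move=> s0 C0 hP; have s0' := ltW s0.
(* D_i = u C v, where u and v bound the outer pieces of the rotated product. *)
have /choice[D hD] (i : 'I_m.+1) : exists D : R, 0 <= D /\ forall n x, pos x ->
    nrm (mx_op L (cyclic_prod i (n.+1 * m.+1)) x) <= D * s ^+ n * nrm x.
  have [_ [u u0 hu]] := mx_op_bounded hL (W_ge0 i (m.+1 - i)) (W_op i (m.+1 - i)).
  have [_ [v v0 hv]] := mx_op_bounded hL (W_ge0 0 i) (W_op 0 i).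
  exists (u * (C * v)); split=> [|n x px]; first by rewrite !mulr_ge0.
  rewrite cyclic_prod_rotate //; apply: le_trans (hu _) _.
  rewrite -!mulrA; apply: ler_wpM2l => //.
  apply: le_trans (hP _ _ _) _; first exact: mx_op_pos.
  rewrite -mulrA; apply: ler_wpM2l => //; rewrite mulrCA.
  by apply: ler_wpM2l; [exact: exprn_ge0|exact: hv].
have growth n x : pos x ->
    nrm (iter (n.+1 * m.+1) (mx_op L (hadamard_prod A)) x)
    <= \prod_i D i * s ^+ (n * m.+1) * nrm x.
  move=> px; rewrite -hadamard_pow_op //.
  have [h1 h2] := hadamard_pow_operator (n.+1 * m.+1).
  (* The rotations other than the one starting at 0 are replaced by these bounds on their
     entries. *)
  have d0 : 0 <= \prod_(i < m) (D (lift ord0 i) * s ^+ n).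
    by apply: prodr_ge0 => i _; rewrite mulr_ge0 ?exprn_ge0 //;
      case: (hD (lift ord0 i)).
  have [|_ dom_le] := dominated_operator h1 (W_ge0 0 (n.+1 * m.+1)) d0 _ (W_op 0 _).
    move=> a b; apply: le_trans (hadamard_pow_le _ _ _) _.
    rewrite big_ord_recl mulrC; apply: ler_wpM2r; first exact: W_ge0.
    apply: ler_prod => i _; rewrite W_ge0 /=.
    by apply: (entry_le_bound hL) => // y py; case: (hD (lift ord0 i)) => _; apply.
  have pW : pos (mx_op L (cyclic_prod 0 (n.+1 * m.+1)) x) by exact: mx_op_pos.
  apply: (@le_trans _ _ (nrm ((\prod_(i < m) (D (lift ord0 i) * s ^+ n))%:C *:
      mx_op L (cyclic_prod 0 (n.+1 * m.+1)) x))).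
    apply: dom_nrm; first exact: posZ.
    move=> j; rewrite pos_nrm_bcoords; last exact: mx_op_pos.
    by rewrite coordZ; exact: dom_le.
  rewrite nrmZp // big_split /= prodr_const card_ord.
  have [_ /(_ n x px) h0] := hD ord0.
  apply: le_trans (ler_wpM2l _ h0) _.
    by move: d0; rewrite big_split /= prodr_const card_ord.
  rewrite big_ord_recl exprM exprS le_eqVlt; apply/orP; left; apply/eqP; ring.
have [lH [h h0 hh]] := mx_op_bounded hL H_ge0 H_op.
(* The 1 covers q = 0; the quotient restores the period lost between n + 1 and n in [growth]. *)
pose D' := 1 + \prod_i D i / s ^+ m.+1.
have Dn0 : 0 <= \prod_i D i by apply: prodr_ge0 => i _; case: (hD i).
have D'1 : 1 <= D' by rewrite lerDl divr_ge0 ?exprn_ge0.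
have growth' q x : pos x ->
    nrm (iter (q * m.+1) (mx_op L (hadamard_prod A)) x)
    <= D' * s ^+ (q * m.+1) * nrm x.
  move=> px; case: q => [|n].
    by rewrite mul0n expr0 mulr1 /= ler_peMl ?nrm_ge0.
  apply: le_trans (growth _ _ px) _; apply: ler_wpM2r; first exact: nrm_ge0.
  rewrite mulSn exprD mulrA; apply: ler_wpM2r; first exact: exprn_ge0.
  by rewrite -ler_pdivrMr ?exprn_gt0 // lerDr ler01.
(* With j = q (m + 1) + r, the last r <= m steps cost at most h^r = (h/s)^r s^r, and (h/s)^r <= (1 +
   h/s)^(m+1) uniformly in r. *)
pose c := (1 + h / s) ^+ m.+1 * D'.
have hs0 : 0 <= h / s by rewrite divr_ge0.
have c0 : 0 <= c.
  by apply: mulr_ge0; [rewrite exprn_ge0 ?addr_ge0|exact: le_trans D'1].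
exists c => // j x.
have [p [pp xp px]] := abs_ex x.
apply: (@le_trans _ _ (c * s ^+ j * nrm p)); last first.
  by apply: ler_wpM2l => //; rewrite mulr_ge0 ?exprn_ge0.
apply: (@le_trans _ _ (nrm (iter j (mx_op L (hadamard_prod A)) p))).
  by apply: dom_nrm; [exact: mx_op_iter_pos|exact: mx_op_iter_dom].
rewrite (divn_eq j m.+1) addnC iterD.
set r := (j %% m.+1)%N; set q := (j %/ m.+1)%N.
apply: le_trans (iter_norm_bound _ _ h0 hh) _.
apply: (@le_trans _ _ (((1 + h / s) ^+ m.+1 * s ^+ r) *
    (D' * s ^+ (q * m.+1) * nrm p))); last first.
  rewrite exprD /c le_eqVlt; apply/orP; left; apply/eqP; ring.
apply: ler_pM; [exact: exprn_ge0|exact: nrm_ge0| |exact: growth'].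
apply: (@le_trans _ _ ((h / s) ^+ r * s ^+ r)).
  by rewrite -exprMn divfK ?gt_eqF.
apply: ler_wpM2r; first exact: exprn_ge0.
apply: (@le_trans _ _ ((1 + h / s) ^+ r)).
  by apply: lerXn2r; rewrite ?nnegrE ?addr_ge0 // lerDr ler01.
by apply: ler_weXn2l; [rewrite lerDl|rewrite ltnW // ltn_mod].
Qed.

Lemma spectral_radius_exp_hadamard :
  spectral_radius (op_exp (mx_op L (hadamard_prod A))) <=
  spectral_radius (op_exp (mx_op L (mx_prod A))).
Proof.
have [P0 hP] : nonneg_mx (mx_prod A) /\ defines_operator L (mx_prod A).
  by rewrite -cyclic_prod_full; exact: cyclic_prod_operator.
have between (u v : R) : u < v -> exists2 t, u < t & t < v.
  by move=> uv; have [h1 h2] := midf_lt uv; exists ((u + v) / 2%:R).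
suff key (r : R) : spectral_radius (op_exp (mx_op L (mx_prod A))) < r ->
    spectral_radius (op_exp (mx_op L (hadamard_prod A))) <= r.
  by apply/ler_addgt0Pr => e e0; apply: key; rewrite ltrDl.
move=> Pr; have [t Pt tr] := between _ _ Pr.
have r_gt1 := spectral_radius_exp_ge1 hL P0 hP Pr.
have s0 : 0 < ln r by exact: ln_gt0.
have sE : expR (ln r) = r by rewrite lnK // posrE (lt_trans ltr01).
have [|C C0 hC] := power_growth hL P0 hP s0 _ Pt; first by rewrite sE.
have [c c0 hc] := hadamard_growth s0 C0 hC.
have bH := mx_op_bounded hL H_ge0 H_op.
rewrite -sE; apply: (spectral_radius_le (op_exp_bounded_linear bH) (expR_ge0 _) c0).
exact: op_exp_growth bH (ltW s0) c0 hc.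
Qed.

End CyclicProducts.

Theorem corollary3p15 (R : realType) (I : index_set) (L : banachSeqSpace R I)
    (hL : normalized L) (m : nat) (hm : (0 < m)%N) (A : 'I_m -> imatrix R I)
    (A_ge0 : forall k, nonneg_mx (A k))
    (A_op : forall k, defines_operator L (A k)) :
  spectral_radius (op_exp (mx_op L (hadamard_prod A))) <=
  spectral_radius (op_exp (mx_op L (mx_prod A))).
Proof.
case: m hm A A_ge0 A_op => [m_gt0|m _] A A_ge0 A_op; first by exfalso.
exact: (spectral_radius_exp_hadamard hL A_ge0 A_op).
Qed.
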